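(* For every $n\ge 6$ the family $\mathcal{T}_n$ is generic in the variety of all $n$-dimensional complex anticommutative nilpotent algebras. Moreover, for every $n\ge 2$ this variety is irreducible and has dimension $\frac{(n-2)(n^2+2n+3)}{6}$.
   Context: All algebras are over $\mathbb{C}$, not necessarily associative. Fix an $n$-dimensional vector space with basis $e_1,\dots,e_n$; algebra structures are identified with points $(c_{ij}^k)\in\mathbb{C}^{n^3}$ of structure constants, $e_ie_j=\sum_kc_{ij}^ke_k$, with Zariski topology; $\mathrm{GL}_n(\mathbb{C})$ acts by change of basis, $O(\mathcal{A})$ denotes an orbit. An algebra is anticommutative if $xy=-yx$ for all $x,y$. $N$ is nilpotent if $N^k=0$ for some $k$, where $N^1=N$, $N^{k+1}=\sum_{i=1}^kN^iN^{k+1-i}$. A family $\mathcal{R}$ in an irreducible variety $\mathfrak{V}$ is generic if $\overline{\bigcup_{\mathcal{A}\in\mathcal{R}}O(\mathcal{A})}=\mathfrak{V}$. Condition ( * ): $c_{ij}^k=0$ whenever $k\le\max\{i,j\}$. For $n\ge6$, $\mathcal{T}_n$ is the family of anticommutative algebra structures satisfying ( * ) such that: $e_ie_{i+1}=e_{i+2}$ for $1\le i\le n-2$; $c_{1i}^{i+2}=c_{2i}^{i+2}=0$ for $4\le i\le n-2$; $c_{13}^4=c_{14}^5=c_{24}^5=c_{15}^6=c_{25}^6=c_{13}^6=0$; $c_{13}^5\neq0$; $c_{35}^6=1$ and (only when $n\ge7$) $c_{46}^7=1$; all other structure constants arbitrary subject only to ( * ) and anticommutativity. *)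

(* Defs.v *)
From HB Require Import structures.
From mathcomp Require Import all_boot all_order all_algebra.
From mathcomp Require Import complex.
From mathcomp Require Import Rstruct.
Set Implicit Arguments. Unset Strict Implicit. Unset Printing Implicit Defensive.
Import Order.TTheory GRing.Theory Num.Theory.
Local Open Scope ring_scope.

Definition C : numClosedFieldType := (Rdefinitions.R)[i].

Inductive polyfun (T : finType) : ((T -> C) -> C) -> Prop :=
| pf_const (a : C) : polyfun (fun _ => a)
| pf_coord (t : T) : polyfun (fun x => x t)
| pf_add f g : polyfun f -> polyfun g -> polyfun (fun x => f x + g x)
| pf_mul f g : polyfun f -> polyfun g -> polyfun (fun x => f x * g x).

Definition zariski_closed (T : finType) (Z : (T -> C) -> Prop) : Prop :=
  exists F : ((T -> C) -> C) -> Prop,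
    (forall f, F f -> polyfun f) /\
    (forall x, Z x <-> (forall f, F f -> f x = 0)).

Definition zariski_closure (T : finType) (S : (T -> C) -> Prop) : (T -> C) -> Prop :=
  fun x => forall Z, zariski_closed Z -> (forall y, S y -> Z y) -> Z x.

Definition irreducible (T : finType) (V : (T -> C) -> Prop) : Prop :=
  (exists x, V x) /\
  forall A B : (T -> C) -> Prop, zariski_closed A -> zariski_closed B ->
    (forall x, V x -> A x \/ B x) ->
    (forall x, V x -> A x) \/ (forall x, V x -> B x).

Definition irr_chain (T : finType) (V : (T -> C) -> Prop) (d : nat)
    (Z : nat -> (T -> C) -> Prop) : Prop :=
  (forall i, (i <= d)%N -> zariski_closed (Z i) /\ irreducible (Z i) /\
                       (forall x, Z i x -> V x)) /\
  (forall i, (i < d)%N -> (forall x, Z i x -> Z i.+1 x) /\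
                      exists x, Z i.+1 x /\ ~ Z i x).

Definition has_dim (T : finType) (V : (T -> C) -> Prop) (d : nat) : Prop :=
  (exists Z, irr_chain V d Z) /\ (forall e Z, irr_chain V e Z -> (e <= d)%N).

Definition idx3 (n : nat) : finType := ('I_n * 'I_n * 'I_n)%type.

(* c (i,j,k) = c_{ij}^k : e_i e_j = sum_k c_{ij}^k e_k. *)
Definition struct (n : nat) := idx3 n -> C.

Definition amul n (c : struct n) (u v : 'rV[C]_n) : 'rV[C]_n :=
  \row_k \sum_(i < n) \sum_(j < n) u 0 i * v 0 j * c (i, j, k).

Definition anticommutative n (c : struct n) : Prop :=
  forall u v, amul c u v = - amul c v u.

(* v belongs to N^k (N^1 = N, N^{k} = sum_{i+j=k} N^i N^j), as the
   linear span of the products. *)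
Inductive in_power n (c : struct n) : nat -> 'rV[C]_n -> Prop :=
| ip_one v : in_power c 1 v
| ip_zero k : in_power c k 0
| ip_add k u v : in_power c k u -> in_power c k v -> in_power c k (u + v)
| ip_scale k a v : in_power c k v -> in_power c k (a *: v)
| ip_mul i j u v : (0 < i)%N -> (0 < j)%N -> in_power c i u -> in_power c j v ->
    in_power c (i + j) (amul c u v).

Definition nilpotent n (c : struct n) : Prop :=
  exists k, (0 < k)%N /\ forall v, in_power c k v -> v = 0.

Definition ACN n : struct n -> Prop :=
  fun c => anticommutative c /\ nilpotent c.

(* Orbit under GL_n (change of basis): c' is in the orbit of c iff c' are
   the structure constants of the algebra c with respect to some basis
   (the rows g_1..g_n of an invertible matrix g). *)
Definition orbit n (c : struct n) : struct n -> Prop :=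
  fun c' => exists g : 'M[C]_n, g \in unitmx /\
    forall i j, amul c (row i g) (row j g) = \sum_(k < n) c' (i, j, k) *: row k g.

Definition generic n (R : struct n -> Prop) (V : struct n -> Prop) : Prop :=
  forall c, zariski_closure (fun c' => exists A, R A /\ orbit A c') c <-> V c.

(* Access to structure constants with the paper's 1-based indices. *)
Definition sc n (c : struct n) (i j k : nat) : C :=
  match (insub i.-1 : option 'I_n), (insub j.-1 : option 'I_n),
        (insub k.-1 : option 'I_n) with
  | Some a, Some b, Some d => c (a, b, d)
  | _, _, _ => 0
  end.

Definition condStar n (c : struct n) : Prop :=
  forall i j k : 'I_n, (k <= maxn i j)%N -> c (i, j, k) = 0.

Definition Tfam n (c : struct n) : Prop :=
  anticommutative c /\ condStar c /\
  (forall i k, (1 <= i <= n - 2)%N -> (1 <= k <= n)%N ->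
      sc c i i.+1 k = (if k == i.+2 then 1 else 0)) /\
  (forall i, (4 <= i <= n - 2)%N -> sc c 1 i i.+2 = 0 /\ sc c 2 i i.+2 = 0) /\
  (sc c 1 3 4 = 0 /\ sc c 1 4 5 = 0 /\ sc c 2 4 5 = 0 /\ sc c 1 5 6 = 0 /\
   sc c 2 5 6 = 0 /\ sc c 1 3 6 = 0) /\
  sc c 1 3 5 != 0 /\
  sc c 3 5 6 = 1 /\ ((7 <= n)%N -> sc c 4 6 7 = 1).

(* Main.v *)
(** With indices starting at 0, let [V_k] be spanned by [e_k, e_(k+1), ...] and
    let [L] be the linear space of anticommutative structures satisfying
    [condStar].  Every nilpotent anticommutative algebra has a basis adapted
    to a central flag, so the variety is [GL_n . L].  The matrices stabilising
    all [V_k] with [k <> 1] preserve [L], hence by LU decomposition the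
    unitriangular matrices with trivial second row, acting on [L], give a
    polynomial map with dense image from an affine space of dimension
    [binom(n+1, 3) - 1].  This yields irreducibility.  For the dimension, a chain
    of length [e] of irreducible closed sets provides [e] algebraically
    independent functions, and counting monomials bounds [e]; conversely,
    switching on the parameters one at a time gives a strict chain, where the
    last parameter is detected on the algebra by a coordinate of
    [e_0 (e_0 (... (e_0 e_1)))].

    For genericity, a pair [f_0, f_1] in a generic algebra of [L] generates a
    basis by [f_(k+2) = f_k f_(k+1)].  Adding multiples of [f_j] to [f_0] and
    [f_1], for increasing [j], kills the structure constants that vanish on
    [T_n], and rescaling normalises the others.  The closure of [GL_n . T_n] is
    [GL_n]-stable, and every genericity assumption is the nonvanishing of a
    polynomial on an affine-linear family of structures, so that it can be
    removed by a density argument along lines. *)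

From mathcomp Require Import all_boot all_order all_algebra.
From mathcomp Require Import complex Rstruct ring zify.
From Stdlib Require Import Classical FunctionalExtensionality.
Require Import Defs.
Set Implicit Arguments. Unset Strict Implicit. Unset Printing Implicit Defensive.
Import Order.TTheory GRing.Theory Num.Theory.
Local Open Scope ring_scope.
(** * Polynomial functions and Zariski closures *)

Lemma polyfun_ext (T : finType) (f g : (T -> C) -> C) :
  f =1 g -> polyfun f -> polyfun g.
Proof. by move=> /functional_extensionality ->. Qed.

Lemma polyfun_scale (T : finType) (a : C) (f : (T -> C) -> C) :
  polyfun f -> polyfun (fun x => a * f x).
Proof. by move=> pf; apply: pf_mul => //; apply: pf_const. Qed.

Lemma polyfun_opp (T : finType) (f : (T -> C) -> C) :
  polyfun f -> polyfun (fun x => - f x).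
Proof.
by move=> pf; apply: polyfun_ext (polyfun_scale (-1) pf) => x; rewrite mulN1r.
Qed.

Lemma polyfun_sub (T : finType) (f g : (T -> C) -> C) :
  polyfun f -> polyfun g -> polyfun (fun x => f x - g x).
Proof. by move=> pf pg; apply: pf_add => //; apply: polyfun_opp. Qed.

Lemma polyfun_sum (T : finType) (I : Type) (r : seq I) (P : pred I)
    (F : I -> (T -> C) -> C) :
  (forall i, P i -> polyfun (F i)) ->
  polyfun (fun x => \sum_(i <- r | P i) F i x).
Proof.
move=> pF; elim: r => [|i r IHr].
  by apply: polyfun_ext (pf_const T 0) => x; rewrite big_nil.
have [Pi|nPi] := boolP (P i).
  by apply: polyfun_ext (pf_add (pF i Pi) IHr) => x; rewrite big_cons Pi.
by apply: polyfun_ext IHr => x; rewrite big_cons (negbTE nPi).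
Qed.

Lemma polyfun_prod (T : finType) (I : Type) (r : seq I) (P : pred I)
    (F : I -> (T -> C) -> C) :
  (forall i, P i -> polyfun (F i)) ->
  polyfun (fun x => \prod_(i <- r | P i) F i x).
Proof.
move=> pF; elim: r => [|i r IHr].
  by apply: polyfun_ext (pf_const T 1) => x; rewrite big_nil.
have [Pi|nPi] := boolP (P i).
  by apply: polyfun_ext (pf_mul (pF i Pi) IHr) => x; rewrite big_cons Pi.
by apply: polyfun_ext IHr => x; rewrite big_cons (negbTE nPi).
Qed.

Lemma polyfun_exp (T : finType) (k : nat) (f : (T -> C) -> C) :
  polyfun f -> polyfun (fun x => f x ^+ k).
Proof.
move=> pf; elim: k => [|k IHk]; first by apply: polyfun_ext (pf_const T 1) => x.
by apply: polyfun_ext (pf_mul pf IHk) => x; rewrite exprS.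
Qed.

Definition polymap (S T : finType) (phi : (S -> C) -> (T -> C)) : Prop :=
  forall t, polyfun (fun x => phi x t).

Lemma polyfun_comp (S T : finType) (phi : (S -> C) -> (T -> C))
    (f : (T -> C) -> C) :
  polymap phi -> polyfun f -> polyfun (fun x => f (phi x)).
Proof.
move=> pphi; elim=> [a|t|{}f g _ IHf _ IHg|{}f g _ IHf _ IHg].
- exact: pf_const.
- exact: pphi.
- exact: pf_add.
- exact: pf_mul.
Qed.

Definition polymx (T : finType) (m n : nat) (A : (T -> C) -> 'M[C]_(m, n)) :=
  forall i j, polyfun (fun x => A x i j).

Lemma polymx_mul (T : finType) m n p (A : (T -> C) -> 'M[C]_(m, n))
    (B : (T -> C) -> 'M[C]_(n, p)) :
  polymx A -> polymx B -> polymx (fun x => A x *m B x).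
Proof.
move=> pA pB i j; apply: (@polyfun_ext _ (fun x => \sum_k A x i k * B x k j)).
  by move=> x; rewrite mxE.
by apply: polyfun_sum => k _; apply: pf_mul.
Qed.

Lemma polyfun_det (T : finType) n (A : (T -> C) -> 'M[C]_n) :
  polymx A -> polyfun (fun x => \det (A x)).
Proof.
move=> pA; apply: polyfun_sum => s _; apply: polyfun_scale.
by apply: polyfun_prod => i _; apply: pA.
Qed.

Lemma polymx_adj (T : finType) n (A : (T -> C) -> 'M[C]_n) :
  polymx A -> polymx (fun x => \adj (A x)).
Proof.
move=> pA i j; apply: (@polyfun_ext _ (fun x => cofactor (A x) j i)).
  by move=> x; rewrite mxE.
apply: polyfun_scale; apply: polyfun_det => k l.
by apply: polyfun_ext (pA (lift j k) (lift i l)) => x; rewrite !mxE.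
Qed.

(** * Density along affine lines *)

Definition line (T : finType) (x y : T -> C) (t : C) : T -> C :=
  fun i => x i + t * (y i - x i).

Lemma line0 (T : finType) (x y : T -> C) : line x y 0 = x.
Proof. by apply: functional_extensionality => i; rewrite /line mul0r addr0. Qed.

Lemma line1 (T : finType) (x y : T -> C) : line x y 1 = y.
Proof. by apply: functional_extensionality => i; rewrite /line mul1r subrKC. Qed.

Lemma polyfun_line (T : finType) (f : (T -> C) -> C) (x y : T -> C) :
  polyfun f -> exists p : {poly C}, forall t, f (line x y t) = p.[t].
Proof.
elim=> [a|i|{}f g _ [p Hp] _ [q Hq]|{}f g _ [p Hp] _ [q Hq]].
- by exists a%:P => t; rewrite hornerC.
- by exists ((x i)%:P + 'X * (y i - x i)%:P) => t; rewrite !hornerE.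
- by exists (p + q) => t; rewrite hornerD Hp Hq.
- by exists (p * q) => t; rewrite hornerM Hp Hq.
Qed.

Lemma poly_nonroot (p : {poly C}) : p != 0 -> exists t, p.[t] != 0.
Proof.
move=> p0; apply: NNPP => noroot.
have all_roots : all (root p) [seq k%:R : C | k <- iota 0 (size p)].
  apply/allP => t _; apply/rootP/eqP/negPn/negP => pt.
  by apply: noroot; exists t.
have uniq_s : uniq [seq k%:R : C | k <- iota 0 (size p)].
  rewrite map_inj_uniq ?iota_uniq // => a b /eqP.
  by rewrite eqr_nat => /eqP.
by have := max_poly_roots p0 all_roots uniq_s; rewrite size_map size_iota ltnn.
Qed.

(** On the line joining [x] to [y] both functions become nonzero univariate polynomials, and so is
    their product. This is irreducibility of affine space in the form used below. *)
Lemma line_common_nonzero (T : finType) (f g : (T -> C) -> C) (x y : T -> C) :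
  polyfun f -> polyfun g -> f x != 0 -> g y != 0 ->
  exists t, f (line x y t) != 0 /\ g (line x y t) != 0.
Proof.
move=> /(polyfun_line x y)[p Hp] /(polyfun_line x y)[q Hq] fx gy.
have p0 : p != 0 by apply: contraNneq fx => p0; rewrite -(line0 x y) Hp p0 horner0.
have q0 : q != 0 by apply: contraNneq gy => q0; rewrite -(line1 x y) Hq q0 horner0.
have [t] := poly_nonroot (mulf_neq0 p0 q0).
by rewrite hornerM mulf_eq0 negb_or -Hp -Hq => /andP[]; exists t.
Qed.

Lemma line_density (T : finType) (f h : (T -> C) -> C) (x y : T -> C) :
  polyfun f -> polyfun h -> h y != 0 ->
  (forall t, h (line x y t) != 0 -> f (line x y t) = 0) -> f x = 0.
Proof.
move=> pf ph hy fh; apply/eqP/negPn/negP => fx.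
have [t [ft ht]] := line_common_nonzero pf ph fx hy.
by rewrite fh ?eqxx in ft.
Qed.

(** The zero locus of a single polynomial is closed, so closures can be tested one polynomial at a
    time. *)
Lemma closureP (T : finType) (S : (T -> C) -> Prop) (x : T -> C) :
  zariski_closure S x <->
  forall f, polyfun f -> (forall y, S y -> f y = 0) -> f x = 0.
Proof.
split=> [clx f pf fS|Hx Z [F [pF HF]] SZ].
  suff: f x = 0 by [].
  apply: (clx (fun y => f y = 0)) => //; exists (fun g => g = f); split.
    by move=> _ ->.
  by move=> y; split=> [fy _ ->|] //; apply.
by apply/HF => f Ff; apply: Hx => [|y /SZ /HF]; [apply: pF|apply].
Qed.

Lemma zariski_closed_closure (T : finType) (S : (T -> C) -> Prop) :
  zariski_closed (zariski_closure S).
Proof.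
exists (fun f => polyfun f /\ forall y, S y -> f y = 0); split=> [f []//|x].
by split=> [/closureP H f [pf fS]|H]; [apply: H|apply/closureP => f pf fS; apply: H].
Qed.

Lemma sub_closure (T : finType) (S : (T -> C) -> Prop) x :
  S x -> zariski_closure S x.
Proof. by move=> Sx Z _; apply. Qed.

Lemma zariski_closed_separated (T : finType) (Z : (T -> C) -> Prop) x :
  zariski_closed Z -> ~ Z x ->
  exists f, [/\ polyfun f, forall y, Z y -> f y = 0 & f x != 0].
Proof.
move=> [F [pF HF]] nZx; apply: NNPP => nf; apply: nZx; apply/HF => f Ff.
apply/eqP/negPn/negP => fx; apply: nf; exists f; split=> //; first exact: pF.
by move=> y /HF; apply.
Qed.

Lemma zero_locus_closed (T : finType) (f : (T -> C) -> C) :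
  polyfun f -> zariski_closed (fun x => f x = 0).
Proof.
move=> pf; exists (fun g => g = f); split=> [_ ->//|x].
by split=> [fx _ ->|] //; apply.
Qed.

Definition line_closed (T : finType) (S : (T -> C) -> Prop) : Prop :=
  forall x y t, S x -> S y -> S (line x y t).

(** If neither [A] nor [B] contains the closure, each has an equation that fails at some image
    point. On the line through the two parameters both equations fail at once, which gives an image
    point outside [A] and [B]. *)
Lemma irreducible_image_closure (S T : finType) (phi : (S -> C) -> (T -> C))
    (X : (S -> C) -> Prop) :
  polymap phi -> line_closed X -> (exists x, X x) ->
  irreducible (zariski_closure (fun y => exists x, X x /\ y = phi x)).
Proof.
move=> pphi lX [x0 Xx0]; split.
  by exists (phi x0); apply: sub_closure; exists x0.
move=> A B cA cB cover; apply: NNPP => /not_or_and[nA nB].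
have witness Z : zariski_closed Z ->
    ~ (forall x, zariski_closure (fun y => exists x, X x /\ y = phi x) x -> Z x) ->
    exists f x, [/\ polyfun f, forall y, Z y -> f y = 0, X x & f (phi x) != 0].
  move=> cZ nZ; have [x [Xx nZx]] : exists x, X x /\ ~ Z (phi x).
    apply: NNPP => nx; apply: nZ => y /(_ _ cZ); apply=> _ [x [Xx ->]].
    by apply: NNPP => nZx; apply: nx; exists x.
  by have [f [pf fZ fx]] := zariski_closed_separated cZ nZx; exists f, x.
have [f [x [pf fA Xx fx]]] := witness A cA nA.
have [g [y [pg gB Xy gy]]] := witness B cB nB.
have [t [ft gt]] :=
  line_common_nonzero (polyfun_comp pphi pf) (polyfun_comp pphi pg) fx gy.
have: zariski_closure (fun y => exists x, X x /\ y = phi x) (phi (line x y t)).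
  by apply: sub_closure; exists (line x y t); split=> //; apply: lX.
by case/cover => [/fA|/gB] /eqP; [rewrite (negbTE ft)|rewrite (negbTE gt)].
Qed.

(** * Structure constants and change of basis *)

Lemma struct_ext n (c c' : struct n) :
  (forall i j k, c (i, j, k) = c' (i, j, k)) -> c = c'.
Proof. by move=> H; apply: functional_extensionality => -[[i j] k]. Qed.

Lemma amulDl n (c : struct n) u v w : amul c (u + v) w = amul c u w + amul c v w.
Proof.
apply/rowP => k; rewrite !mxE -big_split; apply: eq_bigr => i _ /=.
by rewrite -big_split; apply: eq_bigr => j _ /=; rewrite mxE !mulrDl.
Qed.

Lemma amulDr n (c : struct n) u v w : amul c w (u + v) = amul c w u + amul c w v.
Proof.
apply/rowP => k; rewrite !mxE -big_split; apply: eq_bigr => i _ /=.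
by rewrite -big_split; apply: eq_bigr => j _ /=; rewrite mxE mulrDr mulrDl.
Qed.

Lemma amulZl n (c : struct n) a u v : amul c (a *: u) v = a *: amul c u v.
Proof.
apply/rowP => k; rewrite !mxE mulr_sumr; apply: eq_bigr => i _ /=.
by rewrite mulr_sumr; apply: eq_bigr => j _ /=; rewrite mxE !mulrA.
Qed.

Lemma amulZr n (c : struct n) a u v : amul c u (a *: v) = a *: amul c u v.
Proof.
apply/rowP => k; rewrite !mxE mulr_sumr; apply: eq_bigr => i _ /=.
by rewrite mulr_sumr; apply: eq_bigr => j _ /=; rewrite mxE; ring.
Qed.

Lemma amul0l n (c : struct n) u : amul c 0 u = 0.
Proof. by have := amulZl c 0 0 u; rewrite !scale0r. Qed.

Lemma amul0r n (c : struct n) u : amul c u 0 = 0.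
Proof. by have := amulZr c 0 u 0; rewrite !scale0r. Qed.

Lemma amulNl n (c : struct n) u v : amul c (- u) v = - amul c u v.
Proof. by rewrite -scaleN1r amulZl scaleN1r. Qed.

Lemma amulNr n (c : struct n) u v : amul c u (- v) = - amul c u v.
Proof. by rewrite -scaleN1r amulZr scaleN1r. Qed.

Lemma amul_suml n (c : struct n) I (r : seq I) (P : pred I) F v :
  amul c (\sum_(i <- r | P i) F i) v = \sum_(i <- r | P i) amul c (F i) v.
Proof. by apply: (big_morph (fun u => amul c u v)) => [u w|]; rewrite ?amulDl ?amul0l. Qed.

Lemma amul_sumr n (c : struct n) I (r : seq I) (P : pred I) F v :
  amul c v (\sum_(i <- r | P i) F i) = \sum_(i <- r | P i) amul c v (F i).
Proof. by apply: (big_morph (fun u => amul c v u)) => [u w|]; rewrite ?amulDr ?amul0r. Qed.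

Lemma amul_delta n (c : struct n) i j k :
  amul c (delta_mx 0 i) (delta_mx 0 j) 0 k = c (i, j, k).
Proof.
rewrite mxE (bigD1 i) //= (bigD1 j) //= !mxE !eqxx !mul1r.
rewrite [X in _ + X + _]big1 ?addr0; last first.
  by move=> l /negPf lj; rewrite mxE lj andbF mulr0 mul0r.
rewrite big1 ?addr0 // => l /negPf li; rewrite big1 // => m _.
by rewrite mxE li andbF !mul0r.
Qed.

Lemma amulE n (c : struct n) u v :
  amul c u v = \sum_i \sum_j (u 0 i * v 0 j) *: amul c (delta_mx 0 i) (delta_mx 0 j).
Proof.
rewrite {1}(row_sum_delta u) amul_suml; apply: eq_bigr => i _.
rewrite amulZl {1}(row_sum_delta v) amul_sumr scaler_sumr; apply: eq_bigr => j _.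
by rewrite amulZr scalerA.
Qed.

Lemma amul_ext n (c c' : struct n) : (forall u v, amul c u v = amul c' u v) -> c = c'.
Proof. by move=> H; apply: struct_ext => i j k; rewrite -!amul_delta H. Qed.

Lemma anticommutativeP n (c : struct n) :
  anticommutative c <-> forall i j k, c (i, j, k) = - c (j, i, k).
Proof.
split=> [ac i j k|ac u v]; first by rewrite -!amul_delta ac mxE.
apply/rowP => k; rewrite !mxE exchange_big /= -sumrN; apply: eq_bigr => j _.
by rewrite -sumrN; apply: eq_bigr => i _; rewrite (ac i j); ring.
Qed.

Lemma amulvv n (c : struct n) u : anticommutative c -> amul c u u = 0.
Proof.
move=> ac; apply/eqP; have /eqP := ac u u; rewrite -addr_eq0 -mulr2n.
by rewrite -scaler_nat scaler_eq0 pnatr_eq0.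
Qed.

(** The structure constants of [c] in the basis formed by the rows of [g]. *)
Definition tr n (g : 'M[C]_n) (c : struct n) : struct n :=
  fun t => (amul c (row t.1.1 g) (row t.1.2 g) *m invmx g) 0 t.2.

Lemma amul_tr n (g : 'M[C]_n) (c : struct n) u v :
  amul (tr g c) u v = amul c (u *m g) (v *m g) *m invmx g.
Proof.
rewrite (mulmx_sum_row u) (mulmx_sum_row v) amul_suml mulmx_suml amulE; apply: eq_bigr => i _.
rewrite amulZl amul_sumr -scalemxAl mulmx_suml scaler_sumr; apply: eq_bigr => j _.
rewrite amulZr -scalemxAl scalerA; congr (_ *: _); apply/rowP => k.
by rewrite amul_delta.
Qed.

Lemma amul_tr_mul n (g : 'M[C]_n) (c : struct n) u v : g \in unitmx ->
  amul (tr g c) u v *m g = amul c (u *m g) (v *m g).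
Proof. by move=> ug; rewrite amul_tr mulmxKV. Qed.

Lemma tr1 n (c : struct n) : tr 1%:M c = c.
Proof. by apply: amul_ext => u v; rewrite amul_tr !mulmx1 invmx1 mulmx1. Qed.

Lemma tr_mul n (g h : 'M[C]_n) (c : struct n) : g \in unitmx -> h \in unitmx ->
  tr (g *m h) c = tr g (tr h c).
Proof.
move=> ug uh; have ugh : g *m h \in unitmx by rewrite unitmx_mul ug.
apply: amul_ext => u v; apply: (can_inj (mulmxK ugh)).
by rewrite /= [LHS]amul_tr_mul // [RHS]mulmxA (amul_tr_mul _ _ _ ug) amul_tr_mul // !mulmxA.
Qed.

Lemma trK n (g : 'M[C]_n) (c : struct n) : g \in unitmx -> tr (invmx g) (tr g c) = c.
Proof. by move=> ug; rewrite -tr_mul ?unitmx_inv // mulVmx ?tr1. Qed.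

Lemma orbitP n (c c' : struct n) :
  orbit c c' <-> exists g, g \in unitmx /\ c' = tr g c.
Proof.
split=> -[g [ug H]]; exists g; split=> //.
  apply: struct_ext => i j k; rewrite /tr /= H mulmx_suml summxE (bigD1 k) //=.
  rewrite -scalemxAl -row_mul mulmxV // !mxE eqxx mulr1 big1 ?addr0 // => l /negPf lk.
  by rewrite -scalemxAl -row_mul mulmxV // !mxE lk mulr0.
move=> i j; rewrite !rowE -amul_tr_mul // -H mulmx_sum_row.
by apply: eq_bigr => k _; rewrite amul_delta.
Qed.

Lemma tr_anticommutative n (g : 'M[C]_n) (c : struct n) :
  anticommutative c -> anticommutative (tr g c).
Proof. by move=> ac u v; rewrite !amul_tr ac mulNmx. Qed.

Lemma in_power_tr n (g : 'M[C]_n) (c : struct n) k v : g \in unitmx ->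
  in_power (tr g c) k v -> in_power c k (v *m g).
Proof.
move=> ug; elim=> [w|m|m u w _ IHu _ IHw|m a w _ IHw|i j u w i0 j0 _ IHu _ IHw].
- exact: ip_one.
- by rewrite mul0mx; apply: ip_zero.
- by rewrite mulmxDl; apply: ip_add.
- by rewrite -scalemxAl; apply: ip_scale.
- by rewrite amul_tr_mul //; apply: ip_mul.
Qed.

Lemma tr_ACN n (g : 'M[C]_n) (c : struct n) : g \in unitmx -> ACN c -> ACN (tr g c).
Proof.
move=> ug [ac [k [k0 nil]]]; split; first exact: tr_anticommutative.
exists k; split=> // v /(in_power_tr ug) /nil vg0.
by rewrite -(mulmxK ug v) vg0 mul0mx.
Qed.

(** * The flag [V_k] and strictly triangular structures *)

Definition inV n (k : nat) (v : 'rV[C]_n) : Prop := forall i : 'I_n, (i < k)%N -> v 0 i = 0.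

Lemma inV0 n (v : 'rV[C]_n) : inV 0 v.
Proof. by []. Qed.

Lemma inV_0 n k : inV k (0 : 'rV[C]_n).
Proof. by move=> i _; rewrite mxE. Qed.

Lemma inV_n n k (v : 'rV[C]_n) : (n <= k)%N -> inV k v -> v = 0.
Proof. by move=> nk Vv; apply/rowP => i; rewrite Vv ?mxE // (leq_trans _ nk). Qed.

Lemma inV_add n k (u v : 'rV[C]_n) : inV k u -> inV k v -> inV k (u + v).
Proof. by move=> Hu Hv i ik; rewrite mxE Hu // Hv // addr0. Qed.

Lemma inV_scale n k a (v : 'rV[C]_n) : inV k v -> inV k (a *: v).
Proof. by move=> Hv i ik; rewrite mxE Hv // mulr0. Qed.

Lemma inV_opp n k (v : 'rV[C]_n) : inV k v -> inV k (- v).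
Proof. by move=> Hv i ik; rewrite mxE Hv // oppr0. Qed.

Lemma inV_sub n k (u v : 'rV[C]_n) : inV k u -> inV k v -> inV k (u - v).
Proof. by move=> Hu Hv; apply/inV_add/inV_opp. Qed.

Lemma inV_le n k l (v : 'rV[C]_n) : (l <= k)%N -> inV k v -> inV l v.
Proof. by move=> lk Hv i il; apply: Hv; apply: leq_trans lk. Qed.

Lemma inV_sum n k (I : Type) (r : seq I) (P : pred I) (F : I -> 'rV[C]_n) :
  (forall i, P i -> inV k (F i)) -> inV k (\sum_(i <- r | P i) F i).
Proof. by move=> H; elim/big_ind: _ => //; [apply: inV_0|apply: inV_add]. Qed.

Definition Lspace n (c : struct n) : Prop := anticommutative c /\ condStar c.

Lemma inV_mul n (c : struct n) i j k u v : Lspace c -> inV i u -> inV j v ->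
  (k <= i.+1)%N || (k <= j.+1)%N -> inV k (amul c u v).
Proof.
move=> [_ cs] Hu Hv kij l lk; rewrite mxE big1 // => a _; rewrite big1 // => b _.
have [ai|ia] := ltnP a i; first by rewrite Hu // !mul0r.
have [bj|jb] := ltnP b j; first by rewrite Hv // mulr0 mul0r.
rewrite cs ?mulr0 //; lia.
Qed.

(** The squares [e_a e_a] vanish, so only pairs whose larger index is at least [i + 1] contribute;
    hence a gain of two levels instead of one. *)
Lemma inV_mul2 n (c : struct n) i k u v : Lspace c -> inV i u -> inV i v ->
  (k <= i.+2)%N -> inV k (amul c u v).
Proof.
move=> [/anticommutativeP ac cs] Hu Hv kij l lk; rewrite mxE big1 // => a _.
rewrite big1 // => b _.
have [ai|ia] := ltnP a i; first by rewrite Hu // !mul0r.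
have [bi|ib] := ltnP b i; first by rewrite Hv // mulr0 mul0r.
have [ab|ab] := eqVneq a b; last first.
  have : (nat_of_ord a != b)%N by rewrite val_eqE.
  by move=> ab'; rewrite cs ?mulr0 //; lia.
rewrite ab; have /eqP := ac b b l.
by rewrite -addr_eq0 -mulr2n mulrn_eq0 /= => /eqP ->; rewrite mulr0.
Qed.

(** * Nilpotent algebras and adapted bases *)

Lemma mul_copidE n k (v : 'rV[C]_n) i :
  (v *m copid_mx k) 0 i = if (i < k)%N then 0 else v 0 i.
Proof.
rewrite mulmxBr mulmx1 !mxE (bigD1 i) //= big1 ?addr0; last first.
  by move=> j ji; rewrite mxE val_eqE (negbTE ji) mulr0.
by rewrite mxE eqxx /=; case: (i < k)%N; rewrite ?mulr1 ?mulr0 ?subrr ?subr0.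
Qed.

Lemma inV_copid n k (v : 'rV[C]_n) : inV k v <-> v *m copid_mx k = v.
Proof.
split=> [Vv|<- i ik]; last by rewrite mul_copidE ik.
by apply/rowP => i; rewrite mul_copidE; case: ifP => // /Vv.
Qed.

Lemma copid_idem n k : copid_mx k *m copid_mx k = copid_mx k :> 'M[C]_n.
Proof.
apply/row_matrixP => i; rewrite row_mul; apply/inV_copid => j jk.
by rewrite rowE mul_copidE jk.
Qed.

(** These matrices stabilise every [V_k] except possibly [V_1]; since products
   lie in [V_2], they still preserve the strictly triangular algebras. *)
Definition Pmx n (r : 'M[C]_n) : Prop :=
  forall i j : 'I_n, (j < i)%N -> (2 <= i)%N -> r i j = 0.

Lemma Pmx_inV n (r : 'M[C]_n) k v : Pmx r -> k != 1%N -> inV k v -> inV k (v *m r).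
Proof.
move=> Pr k1 Vv l lk; rewrite mxE big1 // => i _.
have [ik|ki] := ltnP i k; first by rewrite Vv // mul0r.
by rewrite Pr ?mulr0 //; lia.
Qed.

(** [r] maps [V_k], the row space of [copid_mx k], injectively into itself, hence onto itself by
    equality of ranks. *)
Lemma Pmx_inV_inv n (r : 'M[C]_n) k v : r \in unitmx -> Pmx r -> k != 1%N ->
  inV k v -> inV k (v *m invmx r).
Proof.
move=> ur Pr k1 /inV_copid Vv.
have stab : (copid_mx k *m r <= (copid_mx k : 'M[C]_n))%MS.
  suff -> : copid_mx k *m r = copid_mx k *m r *m copid_mx k by exact: submxMl.
  apply/row_matrixP => i; rewrite !row_mul; apply/esym/inV_copid/Pmx_inV => //.
  by apply/inV_copid; rewrite -row_mul copid_idem.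
have {}stab : ((copid_mx k : 'M[C]_n) <= copid_mx k *m r)%MS.
  have := mxrank_leqif_sup stab; rewrite mxrankMfree ?row_free_unit // => H.
  by rewrite -H.
have /submxP[X defX] := submxMr (invmx r) stab.
by apply/inV_copid; rewrite mulmxK // in defX; rewrite -Vv -(mulmxA v) defX -!mulmxA copid_idem.
Qed.

Lemma row_inV n (r : 'M[C]_n) (i : 'I_n) : Pmx r -> (2 <= i)%N -> inV i (row i r).
Proof. by move=> Pr i2 j ji; rewrite mxE Pr. Qed.

(** [condStar] says that [e_i e_j] lies in [V_(max(i, j) + 1)]. If the maximum is at least 2, the
    row of larger index lies in its own [V]; for the indices 0 and 1, every product of two vectors
    already lies in [V_2]. *)
Lemma tr_Lspace n (r : 'M[C]_n) (c : struct n) : r \in unitmx -> Pmx r ->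
  Lspace c -> Lspace (tr r c).
Proof.
move=> ur Pr Lc; have [ac cs] := Lc; split; first exact: tr_anticommutative.
move=> i j k; rewrite leq_eqVlt => kij; rewrite /tr /=.
have [ij|ij] := eqVneq i j; first by rewrite ij amulvv // mul0mx mxE.
have ij' : (nat_of_ord i != j)%N by rewrite val_eqE.
suff: inV (maxn i j).+1 (amul c (row i r) (row j r)).
  by move/(Pmx_inV_inv ur Pr) => /(_ _ k); apply; lia.
have [i2|i2] := leqP 2 (maxn i j); last first.
  by apply: (@inV_mul2 _ _ 0%N) => //; lia.
have [ltij|leji] := ltnP i j.
  by apply: (inV_mul Lc (inV0 _) (@row_inV _ _ j Pr _)); lia.
by apply: (inV_mul Lc (@row_inV _ _ i Pr _) (inV0 _)); lia.
Qed.

Lemma Lspace_scale n a (c : struct n) : Lspace c -> Lspace (fun t => a * c t).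
Proof.
move=> [/anticommutativeP ac cs]; split=> [|i j k kij]; last by rewrite cs ?mulr0.
by apply/anticommutativeP => i j k; rewrite ac mulrN.
Qed.

(** All bracketings are allowed, so a product of degree at least [2 ^ m.+1] is only known to have
    one factor of degree at least [2 ^ m]; multiplying then gains one level. *)
Lemma Lspace_in_power n (c : struct n) k v : Lspace c -> in_power c k v ->
  forall m, (2 ^ m <= k)%N -> inV m v.
Proof.
move=> Lc; elim=> {k v} [v|k|k u v _ IHu _ IHv|k a v _ IHv|i j u v i0 j0 _ IHu _ IHv] m Hm.
- suff -> : m = 0%N by [].
  by case: m Hm => // m; have := expn_gt0 2 m; rewrite expnS; lia.
- exact: inV_0.
- by apply: inV_add; [apply: IHu|apply: IHv].
- by apply/inV_scale/IHv.
case: m Hm => [//|m]; rewrite expnS => Hm.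
have [ui|/ltnW ui] := leqP (2 ^ m) i.
  by apply: (@inV_mul _ _ m 0%N) => //; [apply: IHu|rewrite leqnn].
apply: (@inV_mul _ _ 0%N m) => //; last by rewrite leqnn orbT.
by apply: IHv; lia.
Qed.

Lemma Lspace_ACN n (c : struct n) : Lspace c -> ACN c.
Proof.
move=> Lc; split; first by case: Lc.
exists (2 ^ n)%N; split=> [|v]; first by rewrite expn_gt0.
by move/(Lspace_in_power Lc) => /(_ n (leqnn _)); apply: inV_n.
Qed.

(** The nested product [x_1 (x_2 (... (x_k v)))]. Vanishing of all nested products of a fixed length
    is a polynomial condition on [c], and nilpotency is exploited in this form. *)
Definition lprod n (c : struct n) (s : seq 'rV[C]_n) (v : 'rV[C]_n) := foldr (amul c) v s.

Lemma in_power_lprod n (c : struct n) s v : in_power c (size s).+1 (lprod c s v).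
Proof.
elim: s => [|x s IHs] /=; first exact: ip_one.
by apply: (@ip_mul _ _ 1 (size s).+1) => //; apply: ip_one.
Qed.

(** The vectors are listed from the last one to the first one. *)
Fixpoint adapted n (c : struct n) (s : seq 'rV[C]_n) : Prop :=
  if s is v :: s' then
    [/\ adapted c s', v \notin <<s'>>%VS & forall x, amul c x v \in <<s'>>%VS]
  else True.

Lemma adapted_free n (c : struct n) s : adapted c s -> free s.
Proof. by elim: s => [|v s IHs] /=; rewrite ?nil_free // free_cons => -[/IHs -> ->]. Qed.

(** Otherwise every vector outside the span of [s] has a left multiple outside it; iterating [K]
    times contradicts the vanishing of nested products. *)
Lemma adapted_extend n (c : struct n) K s :
  (forall s v, size s = K -> lprod c s v = 0) -> adapted c s -> (size s < n)%N ->
  exists v, adapted c (v :: s).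
Proof.
move=> nil As sn; apply: NNPP => nov.
have [v0 v0s] : exists v0 : 'rV[C]_n, v0 \notin <<s>>%VS.
  apply: NNPP => nv0; have : (dim 'rV[C]_n <= size s)%N.
    rewrite -dimvf (leq_trans _ (dim_span s)) // dimvS //.
    apply/subvP => v _; apply/negPn/negP => vs.
    by apply: nv0; exists v.
  by rewrite /dim /= mul1n leqNgt sn.
have [t [st tv]] : exists t, size t = K /\ lprod c t v0 \notin <<s>>%VS.
  elim: (K) => [|k [t [<- tv]]]; first by exists [::].
  have [x xt] : exists x, amul c x (lprod c t v0) \notin <<s>>%VS.
    apply: NNPP => nx; apply: nov; exists (lprod c t v0); split=> // x.
    by apply/negPn/negP => xt; apply: nx; exists x.
  by exists (x :: t).
by rewrite nil // mem0v in tv.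
Qed.

Lemma adapted_drop n (c : struct n) s i x : adapted c s -> (i < size s)%N ->
  amul c x (nth 0 s i) \in <<drop i.+1 s>>%VS.
Proof.
elim: s i => [|v s IHs] [|i] //= [As _ vs]; first by rewrite drop0.
by move=> /IHs; apply.
Qed.

(** With the vectors of a full adapted list as rows of [g], the span of [drop m s] becomes [V_m].
    Left multiplication sends each vector into the span of its tail, which becomes [condStar] for
    one index and, by anticommutativity, for the other. *)
Lemma adapted_basis n (c : struct n) K : anticommutative c ->
  (forall s v, size s = K -> lprod c s v = 0) ->
  exists g, g \in unitmx /\ Lspace (tr g c).
Proof.
move=> ac nil.
have [s [As ss]] : exists s, adapted c s /\ size s = n.
  suff: forall m, (m <= n)%N -> exists s, adapted c s /\ size s = m by apply.
  elim=> [|m IHm] mn; first by exists [::].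
  have [s [As ss]] := IHm (ltnW mn).
  by have [|v Av] := adapted_extend nil As; [rewrite ss|exists (v :: s); rewrite /= ss].
pose g : 'M[C]_n := \matrix_(i < n) s`_i.
have rowg i : row i g = s`_i by rewrite rowK.
pose X : n.-tuple 'rV[C]_n := Tuple (introT eqP ss).
have spanX v : v \in <<X>>%VS.
  suff -> : <<X>>%VS = fullv by exact: memvf.
  apply/eqP; rewrite eqEdim subvf /= dimvf.
  have /eqP -> : free X := adapted_free As.
  by rewrite ss /dim /= mul1n.
have ug : g \in unitmx.
  rewrite -row_full_unit -sub1mx; apply/row_subP => i.
  rewrite (coord_span (spanX (row i 1%:M))); apply: summx_sub => j _.
  by apply: scalemx_sub; rewrite -rowg row_sub.
have drop_inV m u : u \in <<drop m s>>%VS -> inV m (u *m invmx g).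
  move=> /(@coord_span _ _ _ (in_tuple _)) ->; rewrite mulmx_suml.
  apply: inV_sum => i _; rewrite -scalemxAl; apply: inV_scale.
  have mi : (m + i < n)%N 
    by move: (nat_of_ord i) (ltn_ord i) => i0; rewrite size_drop ss; lia.
  rewrite /= nth_drop -(rowg (Ordinal mi)) -row_mul mulmxV // => j jm.
  by rewrite !mxE -val_eqE /=; case: eqP => // ?; lia.
exists g; split=> //; split; first exact: tr_anticommutative.
move=> i j k; rewrite leq_max => kij; rewrite /tr /= !rowg.
have [ki|ki] := leqP k i.
  apply: (drop_inV i.+1) => //; rewrite ac memvN; apply: adapted_drop => //.
  by rewrite ss.
apply: (drop_inV j.+1); last by move: kij; rewrite leqNgt ki.
by apply: adapted_drop => //; rewrite ss.
Qed.

Lemma lprod_tr n (g : 'M[C]_n) (c : struct n) s v : g \in unitmx ->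
  lprod (tr g c) s v *m g = lprod c [seq x *m g | x <- s] (v *m g).
Proof. by move=> ug; elim: s => //= x s IHs; rewrite amul_tr_mul // IHs. Qed.

Lemma ACN_Lspace n (c : struct n) : ACN c -> exists g, g \in unitmx /\ Lspace (tr g c).
Proof.
move=> [ac [[|k] [// _ nil]]]; apply: (adapted_basis ac (K := k)) => s v sk.
by apply: nil; rewrite -sk; apply: in_power_lprod.
Qed.

(** The length [n] is uniform over all nilpotent structures, which makes nilpotency a closed
    condition. *)
Lemma ACN_lprod n (c : struct n) s v : ACN c -> size s = n -> lprod c s v = 0.
Proof.
move=> /ACN_Lspace[g [ug Lc]] sn; rewrite -(trK c ug).
set c' := tr g c in Lc *; have ug' : invmx g \in unitmx by rewrite unitmx_inv.
apply: (can_inj (mulmxK ug')); rewrite /= lprod_tr // mul0mx.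
have: size [seq x *m invmx g | x <- s] = n by rewrite size_map.
move: {s sn}[seq _ | x <- s] => s sn; apply: (@inV_n _ (size s)); first by rewrite sn.
elim: s {sn} => [|x s IHs] //=.
by apply: (@inV_mul _ _ 0%N (size s)) => //; rewrite leqnn orbT.
Qed.

Lemma polyfun_amul (T : finType) n (A : (T -> C) -> struct n) (u v : (T -> C) -> 'rV[C]_n) k :
  polymap A -> polymx u -> polymx v -> polyfun (fun x => amul (A x) (u x) (v x) 0 k).
Proof.
move=> pA pu pv.
apply: (@polyfun_ext _ (fun x => \sum_i \sum_j u x 0 i * v x 0 j * A x (i, j, k))).
  by move=> x; rewrite mxE.
by apply: polyfun_sum => i _; apply: polyfun_sum => j _; do !apply: pf_mul => //.
Qed.

Lemma polymap_id (T : finType) : polymap (fun x : T -> C => x).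
Proof. by move=> t; apply: pf_coord. Qed.

Lemma polymap_cst (S T : finType) (a : T -> C) : polymap (fun x : S -> C => a).
Proof. by move=> t; apply: pf_const. Qed.

Lemma polymx_cst (T : finType) m n (A : 'M[C]_(m, n)) : polymx (fun x : T -> C => A).
Proof. by move=> i j; apply: pf_const. Qed.

(** Anticommutativity and the vanishing of nested products of length [n] are polynomial equations,
    so they pass to the closure; there they yield an adapted basis and thereby nilpotency. *)
Lemma ACN_closed n (c : struct n) : zariski_closure (@ACN n) c -> ACN c.
Proof.
move=> /closureP clc.
have ac : anticommutative c.
  apply/anticommutativeP => i j k; apply/eqP; rewrite -addr_eq0; apply/eqP.
  apply: (clc (fun c => c (i, j, k) + c (j, i, k))).
    by apply: pf_add; apply: pf_coord.
  by move=> y [/anticommutativeP -> _]; rewrite addNr.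
have nil s v : size s = n -> lprod c s v = 0.
  move=> sn; apply/rowP => k; rewrite [RHS]mxE.
  apply: (clc (fun c => lprod c s v 0 k)) => [|y Ay]; last first.
    by rewrite ACN_lprod // mxE.
  elim: s k {sn} => [|x s IHs] k /=; first exact: pf_const.
  apply: polyfun_amul; [exact: polymap_id|exact: polymx_cst|].
  by move=> i j; rewrite ord1; apply: IHs.
have [g [ug Lg]] := adapted_basis ac nil.
by rewrite -(trK c ug); apply: tr_ACN; rewrite ?unitmx_inv //; apply: Lspace_ACN.
Qed.

(** * A dense parametrization *)

(** The index [(i, j, k)] stands for the structure constant [c_ij^k] when
   [i < j], and for the entry [(k, j)] of a unitriangular matrix when [i = j]. *)
Definition param_idx (n : nat) : finType :=
  {t : idx3 n | (t.1.1 <= t.1.2 < t.2)%N && (2 <= t.2)%N}.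

Definition ext n (x : param_idx n -> C) (t : idx3 n) : C :=
  if insub t is Some s then x s else 0.

Lemma ext_val n (x : param_idx n -> C) s : ext x (val s) = x s.
Proof. by rewrite /ext valK. Qed.

Lemma ext0 n (x : param_idx n -> C) (i j k : 'I_n) :
  ~~ ((i <= j < k) && (2 <= k))%N -> ext x (i, j, k) = 0.
Proof. by move=> H; rewrite /ext insubN. Qed.

Lemma ext_fun n (F : idx3 n -> C) (i j k : 'I_n) :
  ((i <= j < k) && (2 <= k))%N -> ext (fun s => F (val s)) (i, j, k) = F (i, j, k).
Proof. by move=> H; rewrite /ext insubT. Qed.

Lemma polyfun_ext_coord n t : polyfun (fun x : param_idx n -> C => ext x t).
Proof. by rewrite /ext; case: insub => [s|]; [apply: pf_coord|apply: pf_const]. Qed.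

Definition struct_param n (x : param_idx n -> C) : struct n := fun t =>
  if (t.1.1 < t.1.2)%N then ext x t
  else if (t.1.2 < t.1.1)%N then - ext x (t.1.2, t.1.1, t.2) else 0.

(** The index set only has [k >= 2], so rows 0 and 1 are those of the identity. These matrices
    represent lower unitriangular ones up to left factors in [Pmx]. *)
Definition flag_param n (x : param_idx n -> C) : 'M[C]_n :=
  \matrix_(k, j) ((k == j)%:R + ext x (j, j, k)).

(** [\adj] replaces [invmx] so that the map is visibly polynomial. *)
Definition ACN_param n (x : param_idx n -> C) : struct n := fun t =>
  (amul (struct_param x) (row t.1.1 (\adj (flag_param x)))
     (row t.1.2 (\adj (flag_param x))) *m flag_param x) 0 t.2.

Lemma struct_param_Lspace n (x : param_idx n -> C) : Lspace (struct_param x).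
Proof.
split; first apply/anticommutativeP => i j k; last move=> i j k kij.
  by rewrite /struct_param /=; case: ltngtP => _; rewrite ?opprK ?oppr0.
rewrite /struct_param /=; case: ltngtP => ij //; rewrite ext0 ?oppr0 //; lia.
Qed.

Definition unitriangular n (v : 'M[C]_n) : Prop :=
  forall i j : 'I_n, (i <= j)%N -> v i j = (i == j)%:R.

Lemma unitriangular_det n (v : 'M[C]_n) : unitriangular v -> \det v = 1.
Proof.
move=> uv; rewrite det_trig; last first.
  by apply/is_trig_mxP => i j ij; rewrite uv ?(ltnW ij) // -val_eqE ltn_eqF.
by rewrite big1 // => i _; rewrite uv // eqxx.
Qed.

Lemma unitriangular_unit n (v : 'M[C]_n) : unitriangular v -> v \in unitmx.
Proof. by move=> uv; rewrite unitmxE unitriangular_det // unitr1. Qed.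

Lemma flag_param_unitriangular n (x : param_idx n -> C) : unitriangular (flag_param x).
Proof. by move=> i j ij; rewrite mxE ext0 ?addr0 //; lia. Qed.

Lemma ACN_paramE n (x : param_idx n -> C) :
  ACN_param x = tr (invmx (flag_param x)) (struct_param x).
Proof.
have uv := flag_param_unitriangular x; have u := unitriangular_unit uv.
apply: struct_ext => i j k; rewrite /ACN_param /tr /= invmxK.
by rewrite /invmx u unitriangular_det // invr1 scale1r.
Qed.

Lemma ACN_param_ACN n (x : param_idx n -> C) : ACN (ACN_param x).
Proof.
rewrite ACN_paramE; apply: tr_ACN; last exact/Lspace_ACN/struct_param_Lspace.
exact/(etrans (unitmx_inv _))/unitriangular_unit/flag_param_unitriangular.
Qed.

Lemma polymap_ACN_param n : polymap (@ACN_param n).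
Proof.
have pv : polymx (@flag_param n).
  move=> i j; apply: (@polyfun_ext _ (fun x => (i == j)%:R + ext x (j, j, i))).
    by move=> x; rewrite mxE.
  by apply: pf_add; [apply: pf_const|apply: polyfun_ext_coord].
have pc : polymap (@struct_param n).
  move=> t; rewrite /struct_param; case: (_ < _)%N; first exact: polyfun_ext_coord.
  case: (_ < _)%N; last exact: pf_const.
  exact/polyfun_opp/polyfun_ext_coord.
have prow (i : 'I_n) : polymx (fun x : param_idx n -> C => row i (\adj (flag_param x))).
  move=> a j; apply: polyfun_ext (polymx_adj pv i j) => x.
  by rewrite [RHS]mxE.
move=> [[i j] k]; apply: polymx_mul => // a l; rewrite ord1.
exact: polyfun_amul.
Qed.

(** The rescaled Schur complement keeps [lu_poly] polynomial. *)
Definition schur n (g : 'M[C]_(1 + n)) : 'M[C]_n :=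
  g 0 0 *: drsubmx g - dlsubmx g *m ursubmx g.

(** The product of the pivots, up to rescaling: it is nonzero when elimination runs without row
    exchanges. *)
Fixpoint lu_poly n : 'M[C]_n -> C :=
  if n is n'.+1 then fun g : 'M[C]_(1 + n') => g 0 0 * lu_poly (schur g)
  else fun => 1.

Lemma lu_poly1 n : lu_poly (1%:M : 'M[C]_n) = 1.
Proof.
elim: n => //= n IHn; rewrite mxE mul1r.
suff -> : schur (1%:M : 'M[C]_(1 + n)) = 1%:M by [].
apply/matrixP => i j; rewrite !mxE eqxx mul1r eq_rshift.
by rewrite big1 ?subr0 // => l _; rewrite !mxE eq_rlshift mul0r.
Qed.

Lemma polyfun_lu (T : finType) n (A : (T -> C) -> 'M[C]_n) :
  polymx A -> polyfun (fun x => lu_poly (A x)).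
Proof.
elim: n A => [|n IHn] A pA /=; first exact: pf_const.
apply: pf_mul; first exact: pA.
apply: IHn => i j; have := @polymx_mul T n 1 n (fun x => @dlsubmx _ 1 n 1 n (A x))
   (fun x => @ursubmx _ 1 n 1 n (A x)) => pm.
apply: (@polyfun_ext _ (fun x => A x 0 0 * @drsubmx _ 1 n 1 n (A x) i j -
  (@dlsubmx _ 1 n 1 n (A x) *m @ursubmx _ 1 n 1 n (A x)) i j)) => [x|].
  by rewrite !mxE.
apply: polyfun_sub.
  apply: pf_mul; first exact: pA.
  apply: polyfun_ext (pA (rshift 1 i) (rshift 1 j)) => x.
  by rewrite !mxE.
apply: pm => a b.
  by apply: polyfun_ext (pA (rshift 1 a) (lshift n b)) => x; rewrite !mxE.
by apply: polyfun_ext (pA (lshift n a) (rshift 1 b)) => x; rewrite !mxE.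
Qed.

Lemma lu_decomposition n (g : 'M[C]_n) : lu_poly g != 0 ->
  exists v, unitriangular v /\ forall i j : 'I_n, (j < i)%N -> (v *m g) i j = 0.
Proof.
elim: n g => [|n IHn]; first by move=> g; exists 1%:M; split=> -[].
suff step (g : 'M[C]_(1 + n)) : g 0 0 * lu_poly (schur g) != 0 ->
    exists v : 'M[C]_(1 + n), unitriangular v /\
      forall i j : 'I_(1 + n), (j < i)%N -> (v *m g) i j = 0 by exact: step.
rewrite mulf_eq0 negb_or => /andP[g0 /IHn [v [uv tv]]].
(* [w] clears the first column below the pivot and then applies the elimination matrix [v] of the
   Schur complement. *)
pose w : 'M[C]_(1 + n) := block_mx 1%:M 0 (- (g 0 0)^-1 *: (v *m dlsubmx g)) v.
exists w; split=> [i j|i j].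
  case: (split_ordP i) => i' ->; case: (split_ordP j) => j' -> ij.
  - by rewrite block_mxEul mxE !ord1.
  - by rewrite block_mxEur mxE eq_lrshift.
  - by have := ltn_ord j'; move: ij => /=; lia.
  - by rewrite block_mxEdr uv // eq_rshift.
have -> : w *m g = block_mx (ulsubmx g) (ursubmx g) 0 ((g 0 0)^-1 *: (v *m schur g)).
  rewrite -{1}(submxK g) mulmx_block !mul1mx !mul0mx !addr0.
  congr block_mx.
    rewrite [ulsubmx g]mx11_scalar -scalemxAl mul_mx_scalar scalerA.
    have -> : ulsubmx g 0 0 = g 0 0 by rewrite !mxE; congr (g _ _); apply: val_inj.
    by rewrite mulNr mulVf // scaleN1r addNr.
  rewrite /schur mulmxBr -scalemxAr scalerBr scalerA mulVf // scale1r.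
  by rewrite -scalemxAl scaleNr mulmxA addrC.
case: (split_ordP i) => i' ->; case: (split_ordP j) => j' -> ij.
- by move: ij; rewrite !ord1.
- by have := ltn_ord i'; move: ij => /=; lia.
- by rewrite block_mxEdl mxE.
- by rewrite block_mxEdr mxE tv ?mulr0.
Qed.

Lemma Lspace_param n (c : struct n) (v : 'M[C]_n) :
  Lspace c -> unitriangular v ->
  (forall i j : 'I_n, (i < 2)%N -> v i j = (i == j)%:R) ->
  exists x, tr (invmx v) c = ACN_param x.
Proof.
move=> [/anticommutativeP ac cs] uv v2.
pose x (s : param_idx n) :=
  let t := val s in if t.1.1 == t.1.2 then v t.2 t.1.2 else c t.
exists x; rewrite ACN_paramE.
pose F (t : idx3 n) := if t.1.1 == t.1.2 then v t.2 t.1.2 else c t.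
have xE (i j k : 'I_n) : ((i <= j < k) && (2 <= k))%N -> ext x (i, j, k) = F (i, j, k).
  exact: (ext_fun F).
have -> : struct_param x = c.
  apply: struct_ext => i j k; rewrite /struct_param /=; case: ltngtP => ij.
  - have [jk|kj] := ltnP j k.
      by rewrite xE /F /= -?val_eqE ?ltn_eqF //=; lia.
    by rewrite ext0 ?cs //; lia.
  - have [ik|ki] := ltnP i k.
      by rewrite xE /F /= -?val_eqE ?ltn_eqF //= -?ac //; lia.
    by rewrite ext0 ?cs ?oppr0 //; lia.
  - rewrite (val_inj ij); apply/esym/eqP; have /eqP := ac j j k.
    by rewrite -addr_eq0 -mulr2n mulrn_eq0.
congr (tr (invmx _) c); apply/matrixP => k j; rewrite mxE.
have [kj|jk] := leqP k j; first by rewrite uv // ext0 ?addr0 //; lia.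
have [k2|k2] := ltnP k 2; first by rewrite v2 // ext0 ?addr0 //; lia.
rewrite xE /F /= ?eqxx; last by lia.
by rewrite -val_eqE /= gtn_eqF // add0r.
Qed.

Lemma Pmx_inv n (r : 'M[C]_n) : r \in unitmx -> Pmx r -> Pmx (invmx r).
Proof.
move=> ur Pr i j ji i2; suff: inV i (row i (invmx r)) by move/(_ j ji); rewrite mxE.
rewrite rowE; apply: Pmx_inV_inv => //; first by apply: contraTneq i2 => ->.
by move=> l li; rewrite mxE eqxx -val_eqE /= ltn_eqF.
Qed.

(** Factor [v = E *m w], where [w] has trivial rows 0 and 1 and [E] is the identity in all other
    rows. Then [E] is in [Pmx] and is absorbed into the structure. *)
Lemma tr_lower_param n (c : struct n) (v : 'M[C]_n) : Lspace c -> unitriangular v ->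
  exists x, tr (invmx v) c = ACN_param x.
Proof.
move=> Lc uv; pose w : 'M[C]_n := \matrix_(i, j) (if (i < 2)%N then (i == j)%:R else v i j).
have uw : unitriangular w by move=> i j ij; rewrite mxE uv // if_same.
have [Uv Uw] := (unitriangular_unit uv, unitriangular_unit uw).
pose E := v *m invmx w; have UE : E \in unitmx by rewrite unitmx_mul Uv unitmx_inv.
have PE : Pmx E.
  move=> i j ji i2; have : row i E = delta_mx 0 i.
    have -> : row i E = row i w *m invmx w.
      rewrite /E row_mul; congr (_ *m _); apply/rowP => l.
      by rewrite !mxE ltnNge i2.
    by rewrite -row_mul mulmxV // rowE mulmx1.
  by move/rowP => /(_ j); rewrite mxE [RHS]mxE eqxx -val_eqE /= ltn_eqF.
have -> : invmx v = invmx w *m invmx E.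
  apply: (can_inj (mulKmx Uv)); rewrite /= mulmxV //.
  by rewrite mulmxA -/E mulmxV.
rewrite tr_mul ?unitmx_inv //; apply: Lspace_param => //.
  by apply: tr_Lspace; rewrite ?unitmx_inv //; apply: Pmx_inv.
by move=> i j i2; rewrite mxE i2.
Qed.

Lemma lu_param n (c : struct n) (g : 'M[C]_n) : Lspace c -> g \in unitmx ->
  lu_poly g != 0 -> exists x, tr g c = ACN_param x.
Proof.
move=> Lc ug /lu_decomposition[v [uv tv]].
have Uv := unitriangular_unit uv.
have Uvg : v *m g \in unitmx by rewrite unitmx_mul Uv.
have -> : g = invmx v *m (v *m g) by rewrite mulKmx.
rewrite tr_mul ?unitmx_inv //; apply: tr_lower_param => //.
by apply: tr_Lspace => // i j ij _; apply: tv.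
Qed.

Lemma amul_scale n a (c : struct n) u v :
  amul (fun t => a * c t) u v = a *: amul c u v.
Proof.
apply/rowP => k; rewrite !mxE mulr_sumr; apply: eq_bigr => i _.
by rewrite mulr_sumr; apply: eq_bigr => j _; rewrite mulrCA.
Qed.

(** Every point of the variety is [tr g b] with [b] in [L]. On the line from [g] to the identity,
    invertible matrices with an LU decomposition give parametrized points; [f] vanishes there, hence
    at [g]. *)
Lemma ACN_param_dense n (f : struct n -> C) c :
  polyfun f -> (forall x, f (@ACN_param n x) = 0) -> ACN c -> f c = 0.
Proof.
move=> pf f0 /ACN_Lspace[h [uh Lc]].
pose g := invmx h; have ug : g \in unitmx by rewrite unitmx_inv.
rewrite -(trK c uh) -/g; set b := tr h c in Lc *.
pose mx (x : 'I_n * 'I_n -> C) : 'M[C]_n := \matrix_(i, j) x (i, j).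
pose co (A : 'M[C]_n) (t : 'I_n * 'I_n) := A t.1 t.2.
have coK A : mx (co A) = A by apply/matrixP => i j; rewrite mxE.
(* Using [\adj] in [act] introduces a factor [\det (mx x)]; dividing [b] by [\det g] compensates for
   it at [g]. *)
pose b' : struct n := fun t => (\det g)^-1 * b t.
pose act x : struct n := fun t =>
  (amul b' (row t.1.1 (mx x)) (row t.1.2 (mx x)) *m \adj (mx x)) 0 t.2.
have actE x : mx x \in unitmx -> act x = tr (mx x) (fun t => \det (mx x) * b' t).
  move=> ux; apply: struct_ext => i j k.
  rewrite /act /tr /= (amul_scale (\det (mx x))) /invmx ux.
  by rewrite -scalemxAl -(scalemxAr (\det _)^-1) scalerA mulfV ?scale1r //.
have Lb' a : Lspace (fun t => a * b' t) by do 2! apply: Lspace_scale.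
have pmx : polymx mx.
  by move=> i j; apply: polyfun_ext (pf_coord (i, j)) => x; rewrite mxE.
have -> : tr g b = act (co g).
  rewrite actE coK //; congr tr; apply: functional_extensionality => t.
  by rewrite mulVKf // -unitfE -unitmxE.
have pact : polymap act.
  have prow (i : 'I_n) : polymx (fun x : 'I_n * 'I_n -> C => row i (mx x)).
    by move=> l j; apply: polyfun_ext (pmx i j) => x; rewrite [RHS]mxE.
  move=> [[i j] k]; apply: polymx_mul; last exact: polymx_adj.
  move=> a l; rewrite ord1; apply: polyfun_amul => //; exact: polymap_cst.
apply: (@line_density _ (fun x => f (act x)) (fun x => \det (mx x) * lu_poly (mx x))
  _ (co 1%:M)).
- exact: polyfun_comp.
- by apply: pf_mul; [apply: polyfun_det|apply: polyfun_lu].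
- by rewrite coK det1 lu_poly1 mulr1 oner_neq0.
move=> t; set x := line _ _ _; rewrite mulf_eq0 negb_or => /andP[dx lx].
have ux : mx x \in unitmx by rewrite unitmxE unitfE.
have [y Ey] := lu_param (Lb' (\det (mx x))) ux lx.
by rewrite actE // Ey.
Qed.

Lemma ACN_closure_param n (c : struct n) :
  ACN c <-> zariski_closure (fun y => exists x, True /\ y = @ACN_param n x) c.
Proof.
split=> [Ac|clc].
  by apply/closureP => f pf fS; apply: ACN_param_dense => // x; apply: fS; exists x.
apply: ACN_closed; apply/closureP => f pf fA.
by move/closureP: clc => /(_ f pf); apply=> _ [x [_ ->]]; apply/fA/ACN_param_ACN.
Qed.

Lemma irreducible_ext (T : finType) (V W : (T -> C) -> Prop) :
  (forall x, V x <-> W x) -> irreducible V -> irreducible W.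
Proof.
move=> VW [[x /VW Wx] irr]; split=> [|A B cA cB cover]; first by exists x.
have [|H|H] := irr A B cA cB; first by move=> y /VW; apply: cover.
  by left=> y /VW; apply: H.
by right=> y /VW; apply: H.
Qed.

Lemma irreducible_ACN n : irreducible (@ACN n).
Proof.
apply: irreducible_ext (fun c => iff_sym (ACN_closure_param c)) _.
by apply: irreducible_image_closure => //; [apply: polymap_ACN_param|exists (fun=> 0)].
Qed.

(** * Chains of irreducible closed sets *)

(** [Z i] is the closure of the image of the subspace where only the first [i] parameters, in the
    order of [key], may be nonzero. If [t] is the next parameter, [F t] vanishes on [Z i] but not on
    [Z i.+1]. *)
Lemma chain_of_parametrization (D T : finType) (V : (T -> C) -> Prop)
    (phi : (D -> C) -> (T -> C)) (key : D -> nat) (F : D -> (T -> C) -> C) :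
  (forall y, zariski_closure V y -> V y) -> (forall x, V (phi x)) -> polymap phi ->
  (forall t, polyfun (F t)) ->
  (forall t x, (forall t', (key t < key t')%N -> x t' = 0) -> x t = 0 -> F t (phi x) = 0) ->
  (forall t, exists x, (forall t', (key t <= key t')%N -> t' != t -> x t' = 0) /\
                       F t (phi x) <> 0) ->
  exists Z, irr_chain V #|D| Z.
Proof.
move=> cV Vphi pphi pF F0 Fwit.
pose e := sort (relpre key leq) (enum D).
have me t : t \in e by rewrite mem_sort mem_enum.
have e_sorted t t' : (index t e <= index t' e)%N -> (key t <= key t')%N.
  move=> tt'; apply: (@sorted_leq_index _ (relpre key leq)) (me t) (me t') tt' => //.
  - by move=> a b c; apply: leq_trans.
  - by move=> a; apply: leqnn.
  - by apply: sort_sorted => a b; apply: leq_total.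
pose X i (x : D -> C) := forall t, (i <= index t e)%N -> x t = 0.
pose Z i := zariski_closure (fun y => exists x, X i x /\ y = phi x).
have lX i : line_closed (X i).
  by move=> x y s Xx Xy t it; rewrite /line Xx ?Xy // subrr mulr0 addr0.
exists Z; split=> [i _|i iD].
  split; first exact: zariski_closed_closure.
  split; first by apply: irreducible_image_closure => //; exists (fun=> 0).
  move=> y /closureP Zy; apply/cV/closureP => f pf fV; apply: Zy => // _ [x [_ ->]].
  exact/fV/Vphi.
split=> [y /closureP Zy|].
  apply/closureP => f pf fX; apply: Zy => // _ [x [Xx ->]]; apply: fX; exists x.
  by split=> // t /ltnW; apply: Xx.
have [t0 _] : exists t : D, t \in D by apply/card_gt0P; apply: leq_ltn_trans iD.
have ei : (i < size e)%N by rewrite size_sort -cardE.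
pose t := nth t0 e i.
have it : index t e = i by rewrite index_uniq // sort_uniq enum_uniq.
have [x [Hx Fx]] := Fwit t; exists (phi x); split.
  apply: sub_closure; exists x; split=> // t'; rewrite -it => tt'.
  by apply: Hx; [apply: e_sorted; apply: ltnW|apply: contraTneq tt' => ->; rewrite ltnn].
move=> /closureP Zx; apply: Fx; apply: Zx => // _ [z [Xz ->]].
apply: F0 => [t' tt'|]; apply: Xz; rewrite -it //.
by rewrite leqNgt; apply: contraL tt' => /ltnW /e_sorted; rewrite leqNgt.
Qed.

(** * Degree in each variable and counting of monomials *)

Definition degle (D : finType) (d : nat) (f : (D -> C) -> C) : Prop :=
  exists b : {ffun D -> 'I_d.+1} -> C,
    forall x, f x = \sum_al b al * \prod_t x t ^+ al t.

Lemma degle_sum (D I : finType) d (b : I -> C) (e : I -> D -> nat) :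
  (forall i t, (e i t <= d)%N) ->
  degle d (fun x => \sum_i b i * \prod_t x t ^+ e i t).
Proof.
move=> ed; pose h i : {ffun D -> 'I_d.+1} := [ffun t => inord (e i t)].
exists (fun al => \sum_(i | h i == al) b i) => x.
rewrite (partition_big h predT) //=; apply: eq_bigr => al _; rewrite mulr_suml.
apply: eq_bigr => i /eqP <-; congr (_ * _); apply: eq_bigr => t _.
by rewrite ffunE inordK ?ltnS.
Qed.

Lemma degle_ext (D : finType) d (f g : (D -> C) -> C) : f =1 g -> degle d f -> degle d g.
Proof. by move=> /functional_extensionality ->. Qed.

Lemma degle_le (D : finType) d d' (f : (D -> C) -> C) :
  (d <= d')%N -> degle d f -> degle d' f.
Proof.
move=> dd' [b fb]; have al_le (al : {ffun D -> 'I_d.+1}) t : (al t <= d')%N.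
  by apply: leq_trans dd'; rewrite -ltnS.
by apply: degle_ext (degle_sum b al_le) => x; rewrite fb.
Qed.

Lemma degle_const (D : finType) d a : degle d (fun _ : D -> C => a).
Proof.
have H := @degle_sum D unit d (fun=> a) (fun _ _ => 0%N) (fun _ _ => leq0n _).
by apply: degle_ext H => x; rewrite sumr_const card_unit mulr1n big1 ?mulr1.
Qed.

Lemma degle_coord (D : finType) t : degle 1 (fun x : D -> C => x t).
Proof.
have H := @degle_sum D unit 1 (fun=> 1) (fun _ t' => nat_of_bool (t' == t))
  (fun _ _ => leq_b1 _).
apply: degle_ext H => x; rewrite sumr_const card_unit mulr1n mul1r (bigD1 t) //= eqxx.
by rewrite big1 ?mulr1 // => t' /negPf ->.
Qed.

Lemma degle_add (D : finType) d (f g : (D -> C) -> C) :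
  degle d f -> degle d g -> degle d (fun x => f x + g x).
Proof.
move=> [b fb] [b' gb]; exists (fun al => b al + b' al) => x; rewrite fb gb -big_split.
by apply: eq_bigr => al _ /=; rewrite mulrDl.
Qed.

Lemma degle_mul (D : finType) d d' (f g : (D -> C) -> C) :
  degle d f -> degle d' g -> degle (d + d') (fun x => f x * g x).
Proof.
move=> [b fb] [b' gb].
have H := @degle_sum D _ (d + d')
  (fun p : {ffun D -> 'I_d.+1} * {ffun D -> 'I_d'.+1} => b p.1 * b' p.2)
  (fun p t => p.1 t + p.2 t)%N.
have {}H := H (fun p t => leq_add (ltn_ord (p.1 t) : (_ <= d)%N) (ltn_ord (p.2 t) : (_ <= d')%N)).
apply: degle_ext H => x; rewrite fb gb big_distrlr /= pair_big /=.
apply: eq_bigr => p _; rewrite mulrACA -big_split; congr (_ * _).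
by apply: eq_bigr => t _; rewrite exprD.
Qed.

Lemma degle_exp (D : finType) d k (f : (D -> C) -> C) :
  degle d f -> degle (d * k) (fun x => f x ^+ k).
Proof.
move=> df; elim: k => [|k IHk]; first exact: degle_const.
by rewrite mulnS; apply: degle_ext (degle_mul df IHk) => x; rewrite exprS.
Qed.

Lemma polyfun_degle (D : finType) (f : (D -> C) -> C) : polyfun f -> exists d, degle d f.
Proof.
elim=> [a|t|{}f g _ [d df] _ [d' dg]|{}f g _ [d df] _ [d' dg]].
- by exists 0%N; apply: degle_const.
- by exists 1%N; apply: degle_coord.
- exists (maxn d d'); apply: degle_add.
    by apply: degle_le df; apply: leq_maxl.
  by apply: degle_le dg; apply: leq_maxr.
- by exists (d + d')%N; apply: degle_mul.
Qed.

Definition independent_on (T I : finType) (Z : (T -> C) -> Prop)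
    (F : I -> (T -> C) -> C) : Prop :=
  forall a : I -> C, (forall x, Z x -> \sum_i a i * F i x = 0) -> forall i, a i = 0.

(** There are [d.+1 ^ #|D|] exponent vectors, and independence of the functions makes the rows of
    their coefficient matrix independent. *)
Lemma independent_card (D I : finType) d (F : I -> (D -> C) -> C) :
  (forall i, degle d (F i)) -> independent_on (fun=> True) F -> (#|I| <= d.+1 ^ #|D|)%N.
Proof.
move=> /fin_all_exists[b Fb] ind; pose A : finType := {ffun D -> 'I_d.+1}.
have <- : #|A| = (d.+1 ^ #|D|)%N by rewrite card_ffun card_ord.
pose M : 'M[C]_(#|I|, #|A|) := \matrix_(i, al) b (enum_val i) (enum_val al).
suff /eqP <- : row_free M by apply: rank_leq_col.
rewrite -kermx_eq0; apply/eqP/row_matrixP => l; rewrite row0.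
have /(congr1 (row l)) := mulmx_ker M; rewrite row_mul row0.
move: (row l _) => u uM; apply/rowP => j; rewrite [RHS]mxE -(enum_valK j).
apply: (ind (fun i => u 0 (enum_rank i))) => x _.
have {}uM al : \sum_i u 0 (enum_rank i) * b i al = 0.
  move/rowP: uM => /(_ (enum_rank al)); rewrite !mxE => uM; rewrite -[RHS]uM.
  rewrite (reindex (@enum_rank I)) /=; last by apply: onW_bij; apply: enum_rank_bij.
  by apply: eq_bigr => i _; rewrite !mxE !enum_rankK.
under eq_bigr do rewrite Fb mulr_sumr.
rewrite exchange_big /= big1 // => al _.
by under eq_bigr do rewrite mulrA; rewrite -mulr_suml uM mul0r.
Qed.

(** Lowest-order terms in [f] restrict to [Z], where the family [F] is independent. *)
Lemma independent_extend (T I : finType) s (Z Z' : (T -> C) -> Prop)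
    (F : I -> (T -> C) -> C) (f : (T -> C) -> C) :
  (forall i, polyfun (F i)) -> polyfun f -> irreducible Z' ->
  (forall x, Z x -> Z' x) -> (forall x, Z x -> f x = 0) ->
  (exists x, Z' x /\ f x <> 0) -> independent_on Z F ->
  independent_on Z' (fun (p : I * 'I_s) x => F p.1 x * f x ^+ p.2).
Proof.
move=> pF pf [_ irr] ZZ' fZ [x0 [Z'x0 fx0]] ind a aF [i j].
have [m] := ubnP (nat_of_ord j); elim: m => // m IHm in i j *; rewrite ltnS => jm.
have {}IHm i' (j' : 'I_s) : (j' < j)%N -> a (i', j') = 0.
  by move=> j'j; apply: IHm; apply: leq_trans j'j jm.
(* With the coefficients of order below [j] already zero, [f ^+ j * G] vanishes on [Z'].
   Irreducibility cancels [f ^+ j], and on [Z] only the terms of order [j] survive in [G]. *)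
pose G x := \sum_(p : I * 'I_s | (j <= p.2)%N) a p * (F p.1 x * f x ^+ (p.2 - j)).
have pG : polyfun G.
  apply: polyfun_sum => p _; apply: polyfun_scale; apply: pf_mul => //.
  exact: polyfun_exp.
have fG x : Z' x -> f x ^+ j * G x = 0.
  move=> /aF; rewrite (bigID (fun p : I * 'I_s => (j <= p.2)%N)) /=.
  rewrite [X in _ + X]big1 ?addr0; last first.
    by move=> [i' j'] /=; rewrite -ltnNge => /IHm ->; rewrite mul0r.
  move=> <-; rewrite mulr_sumr; apply: eq_bigr => p jp.
  by rewrite -{2}(subnKC jp) exprD; ring.
have [|||fZ'|GZ'] := irr (fun x => f x = 0) (fun x => G x = 0).
- exact: zero_locus_closed.
- exact: zero_locus_closed.
- move=> x /fG /eqP; rewrite mulf_eq0 => /orP[|/eqP]; last by right.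
  by rewrite expf_eq0 => /andP[_ /eqP]; left.
- by have := fx0 (fZ' _ Z'x0).
apply: (ind (fun i => a (i, j))) => x Zx; rewrite -[RHS](GZ' x (ZZ' x Zx)) /G.
transitivity (\sum_(i' : I) \sum_(j' : 'I_s | (j <= j')%N)
    a (i', j') * (F i' x * f x ^+ (j' - j))); last first.
  by rewrite pair_big_dep /=; apply: eq_bigr => -[].
apply: eq_bigr => i' _; rewrite (bigD1 j) //= subnn expr0 mulr1 big1 ?addr0 // => j'.
move=> /andP[jj' j'j]; rewrite fZ // expr0n subn_eq0 leqNgt ltn_neqAle jj' eq_sym.
by rewrite val_eqE j'j /= !mulr0.
Qed.

(** Each strict inclusion supplies a polynomial vanishing on [Z i] but not on [Z i.+1]. Adjoining
    its powers below [s] multiplies the size of the family by [s], while degrees stay linear in [s],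
    with a slope [B] independent of [s]. *)
Lemma chain_independent (D T : finType) (V : (T -> C) -> Prop)
    (phi : (D -> C) -> (T -> C)) e Z :
  polymap phi -> irr_chain V e Z -> forall i, (i <= e)%N ->
  exists B, forall s, exists (I : finType) (F : I -> (T -> C) -> C),
    [/\ #|I| = (s ^ i)%N, forall a, polyfun (F a),
        forall a, degle (B * s) (fun x => F a (phi x)) & independent_on (Z i) F].
Proof.
move=> pphi [cZ sZ]; elim=> [|i IHi] ie.
  exists 0%N => s; exists unit, (fun _ _ => 1); split=> [|_|_|a].
  - by rewrite card_unit.
  - exact: pf_const.
  - exact: degle_const.
  have [_ [[[x Zx] _] _]] := cZ 0%N ie.
  by move=> /(_ x Zx) H []; move: H; rewrite (big_pred1 tt) ?mulr1 // => -[].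
have [B HB] := IHi (ltnW ie); have [ZZ' [x [Z'x nZx]]] := sZ i ie.
have [closedZ _] := cZ i (ltnW ie); have [_ [irrZ' _]] := cZ i.+1 ie.
have [f [pf fZ /eqP fx]] := zariski_closed_separated closedZ nZx.
have [d df] := polyfun_degle (polyfun_comp pphi pf).
exists (B + d)%N => s; have [I [F [cI pF dF indF]]] := HB s.
exists (I * 'I_s)%type, (fun (p : I * 'I_s) x => F p.1 x * f x ^+ p.2); split=> [|p|p|].
- by rewrite card_prod cI card_ord expnSr.
- by apply: pf_mul => //; apply: polyfun_exp.
- rewrite mulnDl; apply: degle_mul => //; apply: degle_le (degle_exp p.2 df).
  by rewrite leq_mul2l ltnW ?orbT.
apply: independent_extend pF pf irrZ' ZZ' fZ _ indF.
by exists x.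
Qed.

Lemma chain_length_le (D T : finType) (V : (T -> C) -> Prop)
    (phi : (D -> C) -> (T -> C)) e Z :
  polymap phi ->
  (forall y, V y -> zariski_closure (fun y => exists x, True /\ y = phi x) y) ->
  irr_chain V e Z -> (e <= #|D|)%N.
Proof.
move=> pphi dense ch; have [B HB] := chain_independent pphi ch (leqnn e).
rewrite leqNgt; apply/negP => De; set m := #|D| in De.
have bound s : (s ^ e <= (B * s).+1 ^ m)%N.
  have [I [F [<- pF dF indF]]] := HB s; apply: (independent_card dF) => a aF.
  apply: indF => y Zy; have [_ [_ ZV]] := ch.1 e (leqnn e).
  move/ZV/dense/closureP: Zy => Zy.
  apply: (Zy (fun y => \sum_i a i * F i y)) => [|_ [x [_ ->]]]; last exact: aF.
  by apply: polyfun_sum => i _; apply: polyfun_scale.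
(* The bound would give [s ^ m.+1 <= (B.+1 * s) ^ m], that is [s <= B.+1 ^ m]. *)
pose s := (B.+1 ^ m).+1; have := bound s.
have le1 : (s ^ m.+1 <= s ^ e)%N by rewrite leq_pexp2l.
have le2 : ((B * s).+1 ^ m <= (B.+1 * s) ^ m)%N.
  have [->|m0] := posnP m; first by rewrite !expn0.
  by rewrite leq_exp2r // mulSn addnC -addn1 leq_add2l.
move=> /(leq_trans le1) /leq_trans /(_ le2).
by rewrite expnMn expnS leq_pmul2r ?expn_gt0 // ltnn.
Qed.

(** * The dimension *)

Lemma sum_ltn n m : (\sum_(i < n) (i < m)%N = minn m n)%N.
Proof.
elim: n => [|n IHn]; first by rewrite big_ord0 minn0.
by rewrite big_ord_recr /= IHn; lia.
Qed.

Lemma sum_ltn_succ n k : (k <= n)%N -> (2 * \sum_(j < n) (j < k) * j.+1 = k * k.+1)%N.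
Proof.
elim: n k => [|n IHn] k; first by rewrite leqn0 => /eqP ->; rewrite big_ord0.
rewrite leq_eqVlt big_ord_recr /= ltnS => /orP[/eqP ->|kn].
  have := IHn n (leqnn n); rewrite ltnS leqnn mul1n.
  have -> : (\sum_(j < n) (j < n.+1) * j.+1 = \sum_(j < n) (j < n) * j.+1)%N.
    by apply: eq_bigr => j _; rewrite ltnS ltnW ?ltn_ord.
  lia.
by rewrite mulnDr IHn // ltnNge kn mul0n muln0 addn0.
Qed.

(** For fixed [k >= 2] there are [k (k + 1) / 2] pairs [i <= j < k]; summing over [k] gives
    [binom(n+1, 3) - 1]. *)
Lemma card_param_idx n : (2 <= n)%N ->
  (#|param_idx n| * 6 = (n - 2) * (n ^ 2 + 2 * n + 3))%N.
Proof.
have -> : #|param_idx n| =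
    (\sum_(k < n) (2 <= k) * \sum_(j < n) (j < k) * j.+1)%N.
  rewrite card_sig -sum1_card big_mkcond /=.
  rewrite -(pair_bigA _ (fun (p : 'I_n * 'I_n) (k : 'I_n) =>
    if ((p.1 <= p.2 < k) && (2 <= k))%N then 1%N else 0%N)) /=.
  rewrite exchange_big /=; apply: eq_bigr => k _.
  rewrite -(pair_bigA _ (fun (i j : 'I_n) =>
    if ((i <= j < k) && (2 <= k))%N then 1%N else 0%N)) /=.
  rewrite exchange_big big_distrr /=; apply: eq_bigr => j _.
  rewrite mulnA; transitivity (\sum_(i < n) ((2 <= k) * (j < k)) * (i < j.+1))%N.
    by apply: eq_bigr => i _; rewrite ltnS; case: (i <= j)%N; case: (j < k)%N; case: (2 <= k)%N.
  by rewrite -big_distrr sum_ltn /=; congr (_ * _)%N; have := ltn_ord j; lia.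
case: n => [|[|m]] // _.
have inner (p : nat) (k : 'I_p) : (2 * \sum_(j < p) (j < k) * j.+1 = k * k.+1)%N.
  by apply: sum_ltn_succ; apply: ltnW.
have {inner}E p : (2 * \sum_(k < p) (2 <= k) * \sum_(j < p) (j < k) * j.+1 =
    \sum_(k < p) (2 <= k) * (k * k.+1))%N.
  rewrite big_distrr /=; apply: eq_bigr => k _.
  by rewrite mulnCA inner.
suff : (3 * \sum_(k < m.+2) (2 <= k) * (k * k.+1) =
    (m.+2 - 2) * (m.+2 ^ 2 + 2 * m.+2 + 3))%N.
  by move=> <-; rewrite -E mulnA mulnC.
elim: m => [|m IHm]; first by rewrite !big_ord_recl big_ord0.
by rewrite big_ord_recr /= mulnDr IHm; nia.
Qed.

(** * A strict chain of maximal length *)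

Lemma ACN_param_flat n (x : param_idx n -> C) :
  (forall j k, ext x (j, j, k) = 0) -> ACN_param x = struct_param x.
Proof.
move=> x0; rewrite ACN_paramE.
have -> : flag_param x = 1%:M by apply/matrixP => k j; rewrite !mxE x0 addr0.
by rewrite invmx1 tr1.
Qed.

Definition lpow n (c : struct n.+2) (k : nat) : 'rV[C]_n.+2 :=
  iter k.-1 (amul c (delta_mx 0 0)) (delta_mx 0 (lift ord0 ord0)).

Lemma lpowS n (c : struct n.+2) k : (0 < k)%N ->
  lpow c k.+1 = amul c (delta_mx 0 0) (lpow c k).
Proof. by case: k. Qed.

Lemma lpow_inV n (c : struct n.+2) k : Lspace c -> (0 < k)%N -> inV k (lpow c k).
Proof.
move=> Lc; elim: k => // -[|k] IHk _.
  by move=> i; rewrite ltnS leqn0 => i0; rewrite mxE -[i == _]val_eqE /= (eqP i0).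
by rewrite lpowS //; apply: (inV_mul Lc (inV0 _) (IHk _)) => //; rewrite leqnn orbT.
Qed.

(** Rows 0 and 1 of [flag_param x] are trivial, so the change of basis fixes [e_0] and [e_1] and
    only acts on the result. *)
Lemma lpow_param n (x : param_idx n.+2 -> C) k :
  lpow (ACN_param x) k = lpow (struct_param x) k *m flag_param x.
Proof.
have uv := flag_param_unitriangular x; have Uv := unitriangular_unit uv.
have fix_row (i : 'I_n.+2) : (i < 2)%N ->
    delta_mx 0 i *m flag_param x = delta_mx 0 i :> 'rV_n.+2.
  move=> i2; apply/rowP => j; rewrite -rowE !mxE eqxx ext0 ?addr0 1?eq_sym //.
  by rewrite negb_and -ltnNge i2 orbT.
rewrite /lpow; elim: k.-1 => [|l IHl] /=; first by rewrite fix_row.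
rewrite IHl ACN_paramE amul_tr invmxK mulmxK //; congr (amul _ _ _ *m _).
by rewrite -{1}(fix_row 0) // mulmxK.
Qed.

(** The matrix entry [(k, j)] is seen in coordinate [j] of [lpow c k]: before the matrix acts this
    vector lies in [V_k], so only rows from [k] on contribute. *)
Definition param_detect n (s : param_idx n.+2) (c : struct n.+2) : C :=
  let t := val s in if t.1.1 == t.1.2 then lpow c t.2 0 t.1.2 else c t.

(** Structure constants come first, then the matrix entries row by row. Thus the matrix is still the
    identity when a structure constant is detected. *)
Definition param_key n (s : param_idx n.+2) : nat :=
  let t := val s in if t.1.1 == t.1.2 then nat_of_ord t.2 else 0%N.

Lemma ext_cases n (x : param_idx n -> C) t :
  ext x t = 0 \/ exists s, val s = t /\ ext x t = x s.
Proof.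
rewrite /ext; case: insubP => [s _ st|_]; last by left.
by right; exists s.
Qed.

Lemma ACN_chain n : exists Z, irr_chain (@ACN n.+2) #|param_idx n.+2| Z.
Proof.
apply: (@chain_of_parametrization _ _ _ (@ACN_param n.+2) (@param_key n)
  (@param_detect n)).
- exact: ACN_closed.
- exact: ACN_param_ACN.
- exact: polymap_ACN_param.
- move=> s; rewrite /param_detect; case: (_ == _); last exact: pf_coord.
  rewrite /lpow; move: (val s).1.2; elim: (val s).2.-1 => [|k IHk] j /=.
    exact: pf_const.
  by apply: polyfun_amul; [exact: polymap_id|exact: polymx_cst|move=> a b; rewrite ord1].
- move=> s x; rewrite /param_key /param_detect.
  case: s => -[[i j] k] ijk /=; have [/andP[/= ij0 jk] /= k2] := andP ijk.
  set s := exist _ _ _.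
  have [ij|ij] := eqVneq i j => key0 xs.
    subst i; rewrite lpow_param mxE big1 // => l _.
    have [lk|kl] := ltnP l k.
      rewrite lpow_inV ?mul0r //; first exact: struct_param_Lspace.
      by apply: leq_trans k2.
    rewrite mxE [l == j](_ : _ = false) ?add0r; last first.
      by apply/eqP => lj; move: jk; rewrite -lj ltnNge kl.
    have [->|[s' [vs' ->]]] := ext_cases x (j, j, l); first by rewrite mulr0.
    move: kl; rewrite leq_eqVlt => /orP[/eqP/val_inj kl|kl].
      have -> : s' = s by apply: val_inj; rewrite vs' /= kl.
      by rewrite xs mulr0.
    by rewrite key0 ?mulr0 // vs' /= eqxx.
  rewrite ACN_param_flat => [|b l].
    rewrite /struct_param /= -[(i, j, k)]/(val s) ext_val xs.
    by move: ij0 ij; rewrite -val_eqE /=; case: ltngtP.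
  have [//|[s' [vs' ->]]] := ext_cases x (b, b, l).
  rewrite key0 // vs' /= eqxx; move: (valP s'); rewrite vs' /=; lia.
move=> [[[i j] k] ijk]; have [/andP[/= ij0 jk] /= k2] := andP ijk.
set s : param_idx n.+2 := exist _ _ _; rewrite /param_key /param_detect.
(* For a matrix entry, the algebra has [e_0 e_l = e_(l+1)] for [l >= 1], so that [lpow] at [k] is
   [e_k], and this entry is 1. For a structure constant, only that constant is switched on. *)
pose x (s' : param_idx n.+2) : C := let t := val s' in
  if i == j then
    if t.1.1 == t.1.2 then (s' == s)%:R else ((t.1.1 == 0) && (t.2 == t.1.2.+1 :> nat))%:R
  else (s' == s)%:R.
exists x; split => /=.
  move=> s'; rewrite /x; case: ifP => ss; last by move=> _ /negPf ->.
  by case: ifP => ss' => [_ /negPf -> //|]; rewrite leqNgt (ltn_trans _ k2).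
have [ij|ij] := eqVneq i j; last first.
  rewrite ACN_param_flat => [|b l].
    rewrite /struct_param /= -[(i, j, k)]/(val s) ext_val /x (negPf ij) eqxx.
    have -> : (i < j)%N by move: ij0 ij; rewrite -val_eqE /=; case: ltngtP.
    exact/eqP/oner_neq0.
  have [//|[s' [vs' ->]]] := ext_cases x (b, b, l).
  rewrite /x (negPf ij); case: eqP => // s's; move: vs'; rewrite s's /= => -[bi bj _].
  by rewrite bi bj eqxx in ij.
subst i; rewrite lpow_param.
have lpowE l : (0 < l)%N -> (l < n.+2)%N -> lpow (struct_param x) l = delta_mx 0 (inord l).
  elim: l => // -[|l] IHl _ ln.
    by congr delta_mx; apply: val_inj; rewrite /= inordK.
  have ln1 : (l.+1 < n.+2)%N := ltnW ln.
  rewrite lpowS // IHl //; apply/rowP => a; rewrite amul_delta.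
  rewrite /struct_param /= inordK //= mxE eqxx /=.
  have [al|al] := eqVneq a (inord l.+2).
    have va : nat_of_ord a = l.+2 by rewrite al inordK.
    pose t : idx3 n.+2 := (0, inord l.+1, a).
    have Ps : ((t.1.1 <= t.1.2 < t.2) && (2 <= t.2))%N.
      by rewrite /= va inordK //= ltnSn.
    rewrite -[(0, _, a)]/(val (Sub t Ps : param_idx n.+2)) ext_val /x eqxx /=.
    by rewrite va inordK // eqxx -val_eqE /= inordK.
  have [//|[s' [vs' ->]]] := ext_cases x (0, inord l.+1, a).
  rewrite /x eqxx vs' /= -val_eqE /= inordK //=.
  case: eqP => // va; case/eqP: al; apply: val_inj.
  by rewrite /= inordK.
have [k0 kn] : (0 < k)%N /\ (k < n.+2)%N by split=> //; apply: leq_trans k2.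
rewrite lpowE // inord_val -rowE !mxE -[(j, j, k)]/(val s) ext_val /x !eqxx.
rewrite [k == j](_ : _ = false) ?add0r; first exact/eqP/oner_neq0.
by apply/eqP => kj; rewrite kj ltnn in jk.
Qed.

Lemma ACN_dim n : (2 <= n)%N -> has_dim (@ACN n) #|param_idx n|.
Proof.
case: n => [|[|n]] // _; split; first exact: ACN_chain.
move=> e Z; apply: (chain_length_le (@polymap_ACN_param n.+2)) => c.
by move/ACN_closure_param.
Qed.

(** * Normal forms *)

(** [E n k] is the paper's [e_(k+1)], and [0] when [n <= k]. *)
Definition E n (k : nat) : 'rV[C]_n := \row_j (nat_of_ord j == k)%:R.

(** Coordinates with a [nat] index, [0] out of range. *)
Definition cf n (v : 'rV[C]_n) (k : nat) : C :=
  if insub k is Some j then v 0 (j : 'I_n) else 0.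

Lemma cf_ord n (v : 'rV[C]_n) (j : 'I_n) : cf v j = v 0 j.
Proof. by rewrite /cf valK. Qed.

Lemma cfD n (u v : 'rV[C]_n) k : cf (u + v) k = cf u k + cf v k.
Proof. by rewrite /cf; case: insub => [j|]; rewrite ?mxE ?addr0. Qed.

Lemma cfZ n a (v : 'rV[C]_n) k : cf (a *: v) k = a * cf v k.
Proof. by rewrite /cf; case: insub => [j|]; rewrite ?mxE ?mulr0. Qed.

Lemma cfN n (v : 'rV[C]_n) k : cf (- v) k = - cf v k.
Proof. by rewrite -scaleN1r cfZ mulN1r. Qed.

Lemma cfE n k l : cf (E n k) l = ((l == k) && (l < n))%N%:R.
Proof.
rewrite /cf; case: insubP => [j lj <-|/negPf ->].
  by rewrite mxE ltn_ord andbT.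
by rewrite andbF.
Qed.

Lemma inV_cf n k l (v : 'rV[C]_n) : inV k v -> (l < k)%N -> cf v l = 0.
Proof. by rewrite /cf => Vv lk; case: insubP => // j _ jl; apply: Vv; rewrite jl. Qed.

Lemma inV_E n k : inV k (E n k).
Proof. by move=> i ik; rewrite mxE ltn_eqF. Qed.

Lemma E_out n k : (n <= k)%N -> E n k = 0.
Proof. by move=> nk; apply: inV_n nk (@inV_E n k). Qed.

Lemma E_delta n (i : 'I_n) : E n i = delta_mx 0 i.
Proof. by apply/rowP => j; rewrite !mxE eqxx. Qed.

Lemma inV_eq n k (u v : 'rV[C]_n) : inV k (u - v) -> inV k v -> inV k u.
Proof. by move=> uv Vv; rewrite -(subrK v u); apply: inV_add. Qed.

Lemma inV_step n k (f v : 'rV[C]_n) : inV k f -> ((k < n)%N -> cf f k != 0) ->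
  inV k v -> inV k.+1 (v - (cf v k / cf f k) *: f).
Proof.
move=> Vf fk Vv i; rewrite ltnS leq_eqVlt => /orP[/eqP ik|ik]; last first.
  by apply: inV_sub ik => //; apply: inV_scale.
rewrite -ik in fk *; have := fk (ltn_ord i); rewrite !mxE !cf_ord => fi.
by rewrite divfK ?subrr.
Qed.

Lemma inV_stepE n k (v : 'rV[C]_n) : inV k v -> inV k.+1 (v - cf v k *: E n k).
Proof.
move=> Vv; have [kn|nk] := ltnP k n; last first.
  by rewrite (inV_n nk Vv) E_out // scaler0 subr0; apply: inV_0.
have := @inV_step n k (E n k) v (@inV_E n k).
by rewrite cfE eqxx kn divr1 oner_neq0 => /(_ (fun=> isT)); apply.
Qed.

(** For [f := E n] this is the normalisation [e_k e_(k+1) = e_(k+2)], with zero in place of vectors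
    beyond the dimension. *)
Definition fib n (c : struct n) (f : nat -> 'rV[C]_n) : Prop :=
  forall k, f k.+2 = amul c (f k) (f k.+1).

Fixpoint fib_seq n (c : struct n) (x y : 'rV[C]_n) (k : nat) : 'rV[C]_n :=
  if k is k'.+1 then fib_seq c y (amul c x y) k' else x.

Lemma fib_seqP n (c : struct n) x y : fib c (fib_seq c x y).
Proof. by move=> k; elim: k x y => // k IHk x y; apply: (IHk y (amul c x y)). Qed.

Definition regular n (f : nat -> 'rV[C]_n) : Prop :=
  forall k, inV k (f k) /\ ((k < n)%N -> cf (f k) k != 0).

Lemma regular_step n (f : nat -> 'rV[C]_n) k v : regular f -> inV k v ->
  exists a, inV k.+1 (v - a *: f k).
Proof.
move=> /(_ k)[Vf fk] Vv; exists (cf v k / cf (f k) k); exact: inV_step.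
Qed.

(** * Perturbing a generating pair *)

Section Perturbation.

Variables (n : nat) (c : struct n) (Lc : Lspace c).
Implicit Types f g : nat -> 'rV[C]_n.

Lemma amul_diff u u' v v' :
  amul c u' v' - amul c u v = amul c (u' - u) v + amul c u' (v' - v).
Proof. by rewrite amulDl amulDr amulNl amulNr [RHS]addrC addrA subrK. Qed.

Lemma inV_mull i u v : inV i u -> inV i.+1 (amul c u v).
Proof. by move=> Vu; apply: (inV_mul Lc Vu (inV0 v)); rewrite leqnn. Qed.

Lemma inV_mulr i u v : inV i v -> inV i.+1 (amul c u v).
Proof. by move=> Vv; apply: (inV_mul Lc (inV0 u) Vv); rewrite leqnn orbT. Qed.

Lemma fib_diff f g k : fib c f -> fib c g ->
  g k.+2 - f k.+2 = amul c (g k - f k) (f k.+1) + amul c (g k) (g k.+1 - f k.+1).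
Proof. by move=> ff fg; rewrite ff fg amul_diff. Qed.

Lemma two_step_ind (P : nat -> Prop) :
  P 0%N -> P 1%N -> (forall k, P k -> P k.+1 -> P k.+2) -> forall k, P k.
Proof.
move=> P0 P1 PS k; suff []: P k /\ P k.+1 by [].
by elim: k => // k [Pk Pk1]; split=> //; apply: PS.
Qed.

(** In [fib_diff], [g k - f k] and [f k.+1] lie in the same [V], so [inV_mul2] gains two levels; the
    other term gains one level over [g k.+1 - f k.+1]. *)
Lemma fib_diff_leading t f g : fib c f -> fib c g -> (forall k, inV (t + k) (f k)) ->
  inV t.+1 (g 0%N - f 0%N) -> inV t.+2 (g 1%N - f 1%N) ->
  forall k, inV (t + k).+1 (g k - f k).
Proof.
move=> ff fg Vf d0 d1; apply: two_step_ind => [||k dk dk1].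
- by rewrite addn0.
- by rewrite addn1.
rewrite fib_diff // !addnS; rewrite addnS in dk1; apply: inV_add.
  by apply: (inV_mul2 Lc dk _ (leqnn _)); have := Vf k.+1; rewrite addnS.
exact: inV_mulr dk1.
Qed.

Lemma fib_diff_const j f g : fib c f -> fib c g ->
  inV j (g 0%N - f 0%N) -> inV j (g 1%N - f 1%N) -> forall k, inV j (g k - f k).
Proof.
move=> ff fg d0 d1; apply: two_step_ind => // k dk dk1.
rewrite fib_diff //; apply: (@inV_le _ j.+1) => //.
by apply: inV_add; [apply: inV_mull|apply: inV_mulr].
Qed.

Lemma fib_diff_gain j f g : fib c f -> fib c g -> (forall k, inV j (g k - f k)) ->
  forall k, inV j.+1 (g k.+2 - f k.+2).
Proof.
move=> ff fg d k; rewrite fib_diff //.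
by apply: inV_add; [apply: inV_mull|apply: inV_mulr].
Qed.

(** The change starts in [V_j], reaches [V_(j+1)] after two steps of the recursion and [V_(j+2)]
    after four. These bounds decide which earlier normalisations survive. *)
Lemma perturb j f a b : fib c f -> regular f -> (2 <= j)%N ->
  exists g, [/\ fib c g, regular g,
    g 0%N = f 0%N + a *: f j, g 1%N = f 1%N + b *: f j &
    forall k, [/\ inV k.+1 (g k - f k), (2 <= k)%N -> inV j.+1 (g k - f k) &
                  (4 <= k)%N -> inV j.+2 (g k - f k)]].
Proof.
move=> ff rf j2; pose g := fib_seq c (f 0%N + a *: f j) (f 1%N + b *: f j).
have fg : fib c g := fib_seqP _ _ _.
have d0 : inV j (g 0%N - f 0%N) by rewrite /g /= addrC addKr; apply/inV_scale/(rf j).1.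
have d1 : inV j (g 1%N - f 1%N) by rewrite /g /= addrC addKr; apply/inV_scale/(rf j).1.
have dj := fib_diff_const ff fg d0 d1; have dj1 := fib_diff_gain ff fg dj.
have dj2 : forall k, inV j.+2 (g k.+4 - f k.+4).
  exact: (@fib_diff_gain _ (fun k => f k.+2) (fun k => g k.+2)
            (fun k => ff k.+2) (fun k => fg k.+2) dj1).
have dk k : inV k.+1 (g k - f k).
  apply: (@fib_diff_leading 0 f g ff fg) => [k'||]; first exact: (rf k').1.
    by apply: inV_le d0; apply: ltnW.
  by apply: inV_le d1.
exists g; split=> // k; last first.
  by split=> //; [case: k => [|[|k]] // _|case: k => [|[|[|[|k]]]] // _].
have [Vf fk] := rf k; split=> [|kn].
  by apply: inV_eq Vf; apply: inV_le (dk k).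
by rewrite -(subrK (f k) (g k)) cfD (inV_cf (dk k)) ?add0r ?fk.
Qed.

Lemma inV_mul_perturb l u u' v v' :
  inV l (amul c u v) -> inV l (amul c (u' - u) v) -> inV l.-1 (v' - v) ->
  inV l (amul c u' v').
Proof.
move=> Vuv Vxv Vd; apply: inV_eq Vuv; rewrite amul_diff; apply: inV_add => //.
by case: l Vd {Vxv} => // l; apply: inV_mulr.
Qed.

(** Modulo [V_l], [p] and [e] are the coefficients of [w] in [u v] and [x v]; adding [a x] to [u]
    cancels the former, and the change of [v] contributes only inside [V_l]. *)
Lemma inV_mul_cancel l e p a u u' v v' w x : inV l (amul c u v - p *: w) ->
  inV l (amul c x v - e *: w) -> p + a * e = 0 ->
  inV l.-1 (v' - v) -> u' = u + a *: x -> inV l (amul c u' v').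
Proof.
move=> Vuv Vxv pae Vd ->.
have -> : amul c (u + a *: x) v' = (amul c u v - p *: w) + a *: (amul c x v - e *: w)
    + amul c (u + a *: x) (v' - v).
  move/eqP: pae; rewrite addr_eq0 => /eqP ->.
  rewrite amulDr amulNr !amulDl !amulZl; apply/rowP => i; rewrite !mxE; ring.
apply: inV_add; first by apply: inV_add => //; apply: inV_scale.
by case: l Vd {Vuv Vxv} => // l; apply: inV_mulr.
Qed.

Definition regular_fib f := fib c f /\ regular f.

Lemma mul_top f v : regular_fib f -> exists a, inV 4 (amul c v (f 2%N) - a *: f 3%N).
Proof. by move=> [_ rf]; apply: (regular_step rf); apply: inV_mulr; apply: (rf 2%N).1. Qed.

(** A multiple of [f_1] is subtracted from [f_0], using [f_1 f_2 = f_3]. *)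
Lemma normalize_first f : regular_fib f ->
  exists g, regular_fib g /\ inV 4 (amul c (g 0%N) (g 2%N)).
Proof.
move=> rff; have [ff rf] := rff; have [p Hp] := mul_top (f 0%N) rff.
pose g := fib_seq c (f 0%N - p *: f 1%N) (f 1%N).
have fg : fib c g := fib_seqP _ _ _.
have dk k : inV k.+1 (g k - f k).
  apply: (@fib_diff_leading 0 f g ff fg) => [k'||].
  - exact: (rf k').1.
  - by rewrite /g /= addrC addKr; apply/inV_opp/inV_scale/(rf 1%N).1.
  - by rewrite /g /= subrr; apply: inV_0.
have rg : regular g.
  move=> k; have [Vf fk] := rf k; split=> [|kn].
    by apply: inV_eq Vf; apply: inV_le (dk k).
  by rewrite -(subrK (f k) (g k)) cfD (inV_cf (dk k)) ?add0r ?fk.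
exists g; split=> //.
apply: (@inV_mul_cancel _ 1 p (- p) (f 0%N) _ (f 2%N) _ (f 3%N) (f 1%N)) => //.
- by rewrite -ff scale1r subrr; apply: inV_0.
- by rewrite mulr1 subrr.
- exact: dk.
- by rewrite /g /= scaleNr.
Qed.

(** For [l3 = l4 = 6] these are the paper's [c_13^4 = 0] and
    [c_1i^k = c_2i^k = 0] for [i = 4, 5] and [k <= 6]. *)
Definition condA l3 l4 f : Prop :=
  [/\ inV 4 (amul c (f 0%N) (f 2%N)), inV l3 (amul c (f 0%N) (f 3%N)),
      inV l3 (amul c (f 1%N) (f 3%N)), inV l4 (amul c (f 0%N) (f 4%N)) &
      inV l4 (amul c (f 1%N) (f 4%N))].

Let amulvv0 u : amul c u u = 0.
Proof. exact: amulvv Lc.1. Qed.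

Lemma inV_mul_reg f u k : regular f -> inV k.+1 (amul c u (f k)).
Proof. by move=> rf; apply: inV_mulr; apply: (rf k).1. Qed.

Lemma inV_shift_mul j f g i a k l : regular f -> g i = f i + a *: f j ->
  (l <= j.+1)%N || ((l <= j.+2)%N && (j == k)) -> inV l (amul c (g i - f i) (f k)).
Proof.
move=> rf ->; rewrite addrC addKr amulZl => H; apply: inV_scale.
case/orP: H => [lj|/andP[_ /eqP ->]]; last by rewrite amulvv0; apply: inV_0.
by apply: inV_le lj _; apply/inV_mull/(rf j).1.
Qed.

(** Multiples of [f_2] are added to [f_0] and [f_1]: [f_2 f_3 = f_4] cancels the unwanted
    coefficients, and [f_2 f_2 = 0] protects [f_0 f_2]. *)
Lemma normalize_A55 f : regular_fib f -> condA 4 5 f ->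
  exists g, regular_fib g /\ condA 5 5 g.
Proof.
move=> [ff rf] [f02 f03 f13 f04 f14].
have [p Hp] := regular_step rf (@inV_mul_reg f (f 0%N) 3 rf).
have [q Hq] := regular_step rf (@inV_mul_reg f (f 1%N) 3 rf).
have [g [fg rg g0 g1 dg]] := perturb (- p) (- q) ff rf (leqnn 2).
have x23 : inV 5 (amul c (f 2%N) (f 3%N) - 1 *: f 4%N).
  by rewrite -ff scale1r subrr; apply: inV_0.
exists g; split; first by split.
split; try exact: inV_mul_reg.
- apply: (inV_mul_perturb f02); last by have [] := dg 2.
  exact: inV_shift_mul g0 _.
- by apply: (inV_mul_cancel Hp x23 _ _ g0); [rewrite mulr1 addrN|have [] := dg 3%N].
- by apply: (inV_mul_cancel Hq x23 _ _ g1); [rewrite mulr1 addrN|have [] := dg 3%N].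
Qed.

(** The same with [f_3]: [f_3 f_4 = f_5] cancels, and [f_3 f_3 = 0] protects the products with
    [f_3]. *)
Lemma normalize_A56 f : regular_fib f -> condA 5 5 f ->
  exists g, regular_fib g /\ condA 5 6 g.
Proof.
move=> [ff rf] [f02 f03 f13 f04 f14].
have [p Hp] := regular_step rf f04.
have [q Hq] := regular_step rf f14.
have [g [fg rg g0 g1 dg]] := perturb (- p) (- q) ff rf (isT : (2 <= 3)%N).
have x34 : inV 6 (amul c (f 3%N) (f 4%N) - 1 *: f 5%N).
  by rewrite -ff scale1r subrr; apply: inV_0.
have d k : inV k.+1 (g k - f k) by have [] := dg k.
exists g; split; first by split.
split.
- by apply: (inV_mul_perturb f02 _ (d 2%N)); apply: inV_shift_mul g0 _.
- by apply: (inV_mul_perturb f03 _ (d 3%N)); apply: inV_shift_mul g0 _.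
- by apply: (inV_mul_perturb f13 _ (d 3%N)); apply: inV_shift_mul g1 _.
- by apply: (inV_mul_cancel Hp x34 _ (d 4%N) g0); rewrite mulr1 addrN.
- by apply: (inV_mul_cancel Hq x34 _ (d 4%N) g1); rewrite mulr1 addrN.
Qed.

(** The same with [f_4]: [f_4 f_3 = - f_5] cancels, and [f_4 f_4 = 0] protects the products with
    [f_4]. *)
Lemma normalize_A66 f : regular_fib f -> condA 5 6 f ->
  exists g, regular_fib g /\ condA 6 6 g.
Proof.
move=> [ff rf] [f02 f03 f13 f04 f14].
have [p Hp] := regular_step rf f03.
have [q Hq] := regular_step rf f13.
have [g [fg rg g0 g1 dg]] := perturb p q ff rf (isT : (2 <= 4)%N).
have x43 : inV 6 (amul c (f 4%N) (f 3%N) - (-1) *: f 5%N).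
  by rewrite Lc.1 -ff scaleN1r opprK addNr; apply: inV_0.
have d k : inV k.+1 (g k - f k) by have [] := dg k.
have d3 : inV 5 (g 3%N - f 3%N) by have [_ H _] := dg 3%N; apply: H.
exists g; split; first by split.
split.
- by apply: (inV_mul_perturb f02 _ (d 2%N)); apply: inV_shift_mul g0 _.
- by apply: (inV_mul_cancel Hp x43 _ d3 g0); rewrite mulrN1 addrN.
- by apply: (inV_mul_cancel Hq x43 _ d3 g1); rewrite mulrN1 addrN.
- by apply: (inV_mul_perturb f04 _ (d 4%N)); apply: inV_shift_mul g0 _.
- by apply: (inV_mul_perturb f14 _ (d 4%N)); apply: inV_shift_mul g1 _.
Qed.

Lemma normalize_A f : regular_fib f -> exists g, regular_fib g /\ condA 6 6 g.
Proof.
move=> /normalize_first[f0 [rf0 f02]].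
have [|f1 [rf1 Af1]] := normalize_A55 rf0.
  by split=> //; apply: inV_mul_reg; apply: rf0.2.
have [f2 [rf2 Af2]] := normalize_A56 rf1 Af1.
exact: normalize_A66 rf2 Af2.
Qed.

(** In the paper's notation, [c_13^5 = p], [c_13^6 = 0], [c_35^6 = d] and
    [c_46^7 = r]. *)
Definition condB p d r f : Prop :=
  [/\ inV 6 (amul c (f 0%N) (f 2%N) - p *: f 4%N),
      inV 6 (amul c (f 2%N) (f 4%N) - d *: f 5%N) &
      inV 7 (amul c (f 3%N) (f 5%N) - r *: f 6%N)].

(** The paper's [c_1i^(i+2) = c_2i^(i+2) = 0] for [4 <= i <= m]. *)
Definition condT m f : Prop := forall k, (3 <= k < m)%N ->
  (exists a, inV k.+3 (amul c (f 0%N) (f k) - a *: f k.+1)) /\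
  (exists a, inV k.+3 (amul c (f 1%N) (f k) - a *: f k.+1)).

Lemma inV_mul_perturb_sub l a u u' v v' w w' :
  inV l (amul c u v - a *: w) -> inV l (amul c (u' - u) v) -> inV l.-1 (v' - v) ->
  inV l (w' - w) -> inV l (amul c u' v' - a *: w').
Proof.
move=> Vuv Vxv Vd Vw.
have -> : amul c u' v' - a *: w' = (amul c u v - a *: w) +
    (amul c (u' - u) v + amul c u' (v' - v)) - a *: (w' - w).
  by rewrite -amul_diff scalerBr; apply/rowP => i; rewrite !mxE; ring.
apply: inV_sub; last exact: inV_scale.
apply: inV_add => //; apply: inV_add => //.
by case: l Vd {Vuv Vxv Vw} => // l; apply: inV_mulr.
Qed.

(** Multiples of [f_(m+1)] are added to [f_0] and [f_1]; as [f_(m+1) f_m = - f_(m+2)], they remove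
    the coefficient of [f_(m+2)] in [f_0 f_m] and [f_1 f_m]. By [perturb] the change is too deep to
    disturb the earlier conditions. *)
Lemma normalize_T_step p d r m f : (4 <= m)%N ->
  regular_fib f -> condA 6 6 f -> condB p d r f -> condT m f ->
  exists g, [/\ regular_fib g, condA 6 6 g, condB p d r g & condT m.+1 g].
Proof.
move=> m4 [ff rf] [f02 f03 f13 f04 f14] [b02 b24 b35] Tf.
have [p1 Hp1] := regular_step rf (@inV_mul_reg f (f 0%N) m rf).
have [q1 Hq1] := regular_step rf (@inV_mul_reg f (f 1%N) m rf).
(* [p1] and [q1] are the coefficients of [f_(m+1)], which remain; [p2] and [q2] are those of
   [f_(m+2)], to be cancelled. *)
have [p2 Hp] := regular_step rf Hp1.
have [q2 Hq] := regular_step rf Hq1.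
have j2 : (2 <= m.+1)%N by lia.
have [g [fg rg g0 g1 dg]] := perturb p2 q2 ff rf j2.
have d1 k : inV k.+1 (g k - f k) by have [] := dg k.
have d2 k l : (2 <= k)%N -> (l <= m.+2)%N -> inV l (g k - f k).
  by move=> k2 lm; have [_ H _] := dg k; apply: inV_le lm (H k2).
have d4 k l : (4 <= k)%N -> (l <= m.+3)%N -> inV l (g k - f k).
  by move=> k4 lm; have [_ _ H] := dg k; apply: inV_le lm (H k4).
have s0 k l : (l <= m.+2)%N -> inV l (amul c (g 0%N - f 0%N) (f k)).
  by move=> lm; apply: inV_shift_mul g0 _; rewrite ?lm.
have s1 k l : (l <= m.+2)%N -> inV l (amul c (g 1%N - f 1%N) (f k)).
  by move=> lm; apply: inV_shift_mul g1 _; rewrite ?lm.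
have s2 k l u : (2 <= k)%N -> (l <= m.+3)%N -> inV l (amul c (g k - f k) u).
  by move=> k2 lm; apply: inV_le lm _; apply: inV_mull; apply: d2.
have mm : (6 <= m.+2)%N by rewrite !ltnS.
exists g; split.
- by split.
- split.
  + by apply: (inV_mul_perturb f02); [apply: s0; lia|apply: d2; lia].
  + by apply: (inV_mul_perturb f03); [apply: s0; lia|apply: d2; lia].
  + by apply: (inV_mul_perturb f13); [apply: s1; lia|apply: d2; lia].
  + by apply: (inV_mul_perturb f04); [apply: s0; lia|apply: d2; lia].
  + by apply: (inV_mul_perturb f14); [apply: s1; lia|apply: d2; lia].
- split.
  + by apply: (inV_mul_perturb_sub b02); [apply: s0|apply: d2; lia|apply: d4; lia].
  + by apply: (inV_mul_perturb_sub b24); [apply: s2; lia|apply: d2; lia|apply: d4; lia].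
  + by apply: (inV_mul_perturb_sub b35); [apply: s2; lia|apply: d4; lia|apply: d4; lia].
move=> k /andP[k3]; rewrite ltnS leq_eqVlt => /orP[/eqP ->|km]; last first.
  have [[a Ha] [b Hb]] := Tf k (introT andP (conj k3 km)); split.
    exists a; apply: (inV_mul_perturb_sub Ha); [apply: s0; lia|apply: d2; lia|].
    by apply: d4; lia.
  exists b; apply: (inV_mul_perturb_sub Hb); [apply: s1; lia|apply: d2; lia|].
  by apply: d4; lia.
have xm : inV m.+3 (amul c (f m.+1) (f m) - (-1) *: f m.+2).
  by rewrite Lc.1 -ff scaleN1r opprK addNr; apply: inV_0.
have cancel i s t (Hi : inV m.+3 (amul c (f i) (f m) - s *: f m.+1 - t *: f m.+2)) :
    g i = f i + t *: f m.+1 -> inV m.+3 (amul c (g i) (g m) - s *: g m.+1).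
  move=> gi; have -> : amul c (g i) (g m) - s *: g m.+1 =
      (amul c (f i) (f m) - s *: f m.+1 - t *: f m.+2) +
      t *: (amul c (f m.+1) (f m) - (-1) *: f m.+2) +
      amul c (g i) (g m - f m) - s *: (g m.+1 - f m.+1).
    rewrite amulDr amulNr gi !amulDl !amulZl.
    by apply/rowP => l; rewrite !mxE; ring.
  apply: inV_sub; last by apply/inV_scale/d4; lia.
  apply: inV_add; first by apply: inV_add => //; apply: inV_scale.
  by apply: inV_mulr; apply: d2; lia.
by split; [exists p1; apply: cancel Hp g0|exists q1; apply: cancel Hq g1].
Qed.

Lemma normalize_T p d r m f : (4 <= m)%N -> regular_fib f -> condA 6 6 f ->
  condB p d r f -> exists g, [/\ regular_fib g, condA 6 6 g, condB p d r g & condT m g].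
Proof.
move=> + rf Af Bf; elim: m => // m IHm; rewrite leq_eqVlt => /orP[/eqP [<-]|m4].
  have [_ f03 f13 _ _] := Af; exists f; split=> // k k3.
  have -> : k = 3%N by lia.
  by split; exists 0; rewrite scale0r subr0.
have [g [rg Ag Bg Tg]] := IHm m4; exact: (normalize_T_step m4 rg Ag Bg Tg).
Qed.

Definition cond_units f : Prop :=
  [/\ exists2 p, p != 0 & inV 6 (amul c (f 0%N) (f 2%N) - p *: f 4%N),
      inV 6 (amul c (f 2%N) (f 4%N) - f 5%N) & inV 7 (amul c (f 3%N) (f 5%N) - f 6%N)].

(** Rescaling [f_0], [f_1] by [r / d] and [d] multiplies [f_2] by [r] and [f_3]
   by [d r]. *)
Lemma rescale p d r m f : p != 0 -> d != 0 -> r != 0 ->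
  regular_fib f -> condA 6 6 f -> condB p d r f -> condT m f ->
  exists g, [/\ regular_fib g, condA 6 6 g, cond_units g & condT m g].
Proof.
move=> p0 d0 r0 [ff rf] [f02 f03 f13 f04 f14] [b02 b24 b35] Tf.
pose mu := fix mu (a b : C) (k : nat) := if k is k'.+1 then mu b (a * b) k' else a.
have mufS k a b : mu a b k.+2 = mu a b k * mu a b k.+1.
  by elim: k a b => // k IHk a b; apply: (IHk b (a * b)).
have mu_neq0 k a b : a != 0 -> b != 0 -> mu a b k != 0.
  by elim: k a b => //= k IHk a b a0 b0; apply: IHk; rewrite ?mulf_neq0.
(* The scalars obey [nu_(k+2) = nu_k nu_(k+1)], so the rescaled sequence keeps its recursion. The
   two normalisations ask for [nu_1 = d] and [nu_2 = nu_0 nu_1 = r]. *)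
pose nu := mu (r / d) d.
have nuS k : nu k.+2 = nu k * nu k.+1 by apply: mufS.
have nu0 k : nu k != 0 by apply: mu_neq0 => //; rewrite mulf_neq0 ?invr_neq0.
have nu2 : nu 2%N = r by rewrite /nu /= divfK.
have nu3 : nu 3%N = d * nu 2%N by rewrite nuS.
clearbody nu => {mufS mu_neq0}.
pose g k := nu k *: f k.
have mulg l i j : inV l (amul c (f i) (f j)) -> inV l (amul c (g i) (g j)).
  by move=> Vf; rewrite /g amulZl amulZr; do 2 apply: inV_scale.
have mulg_sub l i j k a q : inV l (amul c (f i) (f j) - a *: f k) ->
    q * nu k = nu i * nu j * a -> inV l (amul c (g i) (g j) - q *: g k).
  move=> Vf qa; rewrite /g amulZl amulZr !scalerA qa.
  rewrite -[(nu i * nu j * a) *: _]scalerA -scalerBr.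
  exact: inV_scale.
have mulg_ex l i j k a : inV l (amul c (f i) (f j) - a *: f k) ->
    inV l (amul c (g i) (g j) - (nu i * nu j * a / nu k) *: g k).
  by move/mulg_sub; apply; rewrite divfK.
exists g; split.
- split=> k; first by rewrite /g nuS ff amulZl amulZr scalerA.
  have [Vf fk] := rf k; split=> [|kn]; first exact: inV_scale.
  by rewrite cfZ mulf_neq0 ?fk.
- by split; apply: mulg.
- split.
  + exists (nu 0%N * nu 2%N * p / nu 4%N); last exact: mulg_ex.
    by rewrite !mulf_neq0 ?invr_neq0.
  + rewrite -[g 5%N]scale1r; apply: (mulg_sub _ _ _ _ _ _ b24).
    by rewrite mul1r (nuS 3%N) nu3; ring.
  + rewrite -[g 6%N]scale1r; apply: (mulg_sub _ _ _ _ _ _ b35).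
    by rewrite mul1r (nuS 4%N) (nuS 2%N) nu2; ring.
- move=> k km; have [[a Ha] [b Hb]] := Tf k km.
  by split; [exists (nu 0%N * nu k * a / nu k.+1)|exists (nu 1%N * nu k * b / nu k.+1)];
     apply: mulg_ex.
Qed.

End Perturbation.

(** Weaker than [regular]: [f_1] is only triangular modulo [f_0]. *)
Definition frame n (f : nat -> 'rV[C]_n) : Prop :=
  (forall k, (2 <= k)%N -> inV k (f k)) /\
  (forall k, (k < n)%N -> exists a, inV k (f k + a *: f 0%N) /\ cf (f k + a *: f 0%N) k != 0).

Lemma regular_frame n (f : nat -> 'rV[C]_n) : regular f -> frame f.
Proof.
move=> rf; split=> [k _|k kn]; first exact: (rf k).1.
by exists 0; rewrite scale0r addr0; have [Vf /(_ kn)] := rf k.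
Qed.

(** The matrix with rows [f_k] is invertible and in [Pmx], so it preserves [L] and turns conditions
    on [f] into conditions on the standard basis, at every level but [V_1]. *)
Lemma frame_transport n (c : struct n) (f : nat -> 'rV[C]_n) : (2 <= n)%N ->
  Lspace c -> frame f -> exists g, [/\ g \in unitmx, Lspace (tr g c),
    fib c f -> fib (tr g c) (E n) &
    forall k i j l q, k != 1%N -> inV k (amul c (f i) (f j) - q *: f l) ->
      inV k (amul (tr g c) (E n i) (E n j) - q *: E n l)].
Proof.
move=> n2 Lc [Vf Nf]; pose g : 'M[C]_n := \matrix_(i < n) f i.
have Eg k : E n k *m g = f k.
  have [kn|nk] := ltnP k n.
    by rewrite -[k]/(nat_of_ord (Ordinal kn)) E_delta -rowE rowK.
  rewrite E_out // mul0mx; apply/esym/(inV_n nk)/Vf.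
  exact: leq_trans nk.
have Pg : Pmx g.
  by move=> i j ji i2; rewrite mxE; apply: Vf.
have full k u : inV (n - k) u -> (u <= g)%MS.
  elim: k u => [|k IHk] u Vu.
    by rewrite (inV_n _ Vu) ?subn0 // sub0mx.
  have [nk|kn] := leqP n k.
    by apply: IHk; apply: inV_le Vu; rewrite (eqP (nk : n - k == 0)%N).
  have ltn : (n - k.+1 < n)%N by lia.
  have [a [Va Na]] := Nf _ ltn.
  set v := _ + _ in Va Na.
  have := inV_step Va (fun _ => Na) Vu; rewrite -subSn // subSS => /IHk Hu.
  rewrite -(subrK ((cf u (n - k.+1) / cf v (n - k.+1)) *: v) u).
  apply: addmx_sub => //; apply: scalemx_sub; rewrite /v -!Eg.
  by rewrite scalemxAl -mulmxDl submxMl.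
have ug : g \in unitmx.
  rewrite -row_full_unit -sub1mx; apply/row_subP => i.
  by apply: (full n); rewrite subnn.
exists g; split=> // [|ff k|k i j l q k1 H]; first exact: tr_Lspace.
  by rewrite amul_tr !Eg -ff -Eg mulmxK.
rewrite amul_tr !Eg -(mulmxK ug (E n l)) Eg scalemxAl -mulmxBl.
exact: Pmx_inV_inv.
Qed.

Lemma regular_E n : regular (E n).
Proof. by move=> k; split=> [|kn]; [exact: inV_E|rewrite cfE eqxx kn oner_neq0]. Qed.

Lemma scE n (c : struct n) i j k :
  sc c i.+1 j.+1 k.+1 = cf (amul c (E n i) (E n j)) k.
Proof.
rewrite /sc /=; case: insubP => [a _ <-|]; last first.
  by rewrite -leqNgt => ni; rewrite (E_out ni) amul0l /cf; case: insub => // ?; rewrite mxE.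
case: insubP => [b _ <-|]; last first.
  by rewrite -leqNgt => nj; rewrite (E_out nj) amul0r /cf; case: insub => // ?; rewrite mxE.
by rewrite !E_delta /cf; case: insub => // l; rewrite amul_delta.
Qed.

Lemma polyfun_sc n i j k : polyfun (fun c : struct n => sc c i j k).
Proof.
rewrite /sc; case: insub => [a|]; last exact: pf_const.
case: insub => [b|]; last exact: pf_const.
by case: insub => [d|]; [exact: pf_coord|exact: pf_const].
Qed.

Lemma Tfam_of_cond n (c : struct n) : (6 <= n)%N -> Lspace c -> fib c (E n) ->
  condA c 6 6 (E n) -> cond_units c (E n) -> condT c n (E n) -> Tfam c.
Proof.
move=> n6 [ac cs] fE [f02 f03 f13 f04 f14] [[p p0 b02] b24 b35] Tc.
have cf0 k l (v : 'rV_n) : inV k v -> (l < k)%N -> cf v l = 0 by exact: inV_cf.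
have cfs k l (v : 'rV_n) a m : inV k (v - a *: E n m) -> (l < k)%N ->
    cf v l = a * ((l == m) && (l < n))%N%:R.
  move=> Vv lk; apply/eqP; rewrite -subr_eq0 -cfE -cfZ -cfN -cfD.
  by apply/eqP; apply: inV_cf Vv lk.
split=> //; split=> //; split.
  move=> [|i] [|k] // /andP[_ i2] /andP[_ kn]; rewrite scE -fE cfE eqSS kn andbT.
  by case: (_ == _).
split.
  move=> [|i] // /andP[i3 i2]; have [|[a Ha] [b Hb]] := Tc i; first by lia.
  rewrite !scE (cfs _ _ _ _ _ Ha) // (cfs _ _ _ _ _ Hb) //.
  by rewrite gtn_eqF ?ltnSn //= !mulr0.
split.
  rewrite !scE (cf0 _ _ _ f02) // (cf0 _ _ _ f03) // (cf0 _ _ _ f13) //.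
  by rewrite (cf0 _ _ _ f04) // (cf0 _ _ _ f14) // (cfs _ _ _ _ _ b02) //= mulr0.
split.
  rewrite scE (cfs _ _ _ _ _ b02) //= ltnW ?mulr1 //.
rewrite -(scale1r (E n 5)) in b24; rewrite -(scale1r (E n 6)) in b35.
split=> [|n7]; rewrite scE; [rewrite (cfs _ _ _ _ _ b24)|rewrite (cfs _ _ _ _ _ b35)] => //.
  by rewrite eqxx n6 mulr1.
by rewrite eqxx n7 mulr1.
Qed.

Lemma cond_transport n (c : struct n) f : (2 <= n)%N -> Lspace c -> fib c f -> frame f ->
  exists g, [/\ g \in unitmx, Lspace (tr g c), fib (tr g c) (E n),
    (forall k i j, k != 1%N -> inV k (amul c (f i) (f j)) ->
      inV k (amul (tr g c) (E n i) (E n j))) &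
    forall k i j l q, k != 1%N -> inV k (amul c (f i) (f j) - q *: f l) ->
      inV k (amul (tr g c) (E n i) (E n j) - q *: E n l)].
Proof.
move=> n2 Lc ff frf; have [g [ug Lg fg tg]] := frame_transport n2 Lc frf.
exists g; split=> //; first exact: fg.
move=> k i j k1 H; rewrite -(subr0 (amul _ _ _)) -(scale0r (E n 0)).
by apply: tg => //; rewrite scale0r subr0.
Qed.

Lemma reach_T n (c : struct n) p d r : (6 <= n)%N -> p != 0 -> d != 0 -> r != 0 ->
  Lspace c -> fib c (E n) -> condA c 6 6 (E n) -> condB c p d r (E n) ->
  exists g, g \in unitmx /\ Tfam (tr g c).
Proof.
move=> n6 p0 d0 r0 Lc fE AE BE; have n4 : (4 <= n)%N by lia.
have [f [rf Af Bf Tf]] := normalize_T Lc n4 (conj fE (@regular_E n)) AE BE.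
have {rf Af Bf Tf}[{}f [[ff rf] Af Uf Tf]] := rescale p0 d0 r0 rf Af Bf Tf.
have n2 : (2 <= n)%N by lia.
have [g [ug Lg fg tg tsg]] := cond_transport n2 Lc ff (regular_frame rf).
exists g; split=> //; apply: Tfam_of_cond => //.
- by have [? ? ? ? ?] := Af; split; apply: tg.
- have [[q q0 Hq] H24 H35] := Uf; split; first by exists q => //; apply: tsg.
    by rewrite -[E n 5]scale1r; apply: tsg; rewrite ?scale1r.
  by rewrite -[E n 6]scale1r; apply: tsg; rewrite ?scale1r.
- move=> k km; have [[a Ha] [b Hb]] := Tf k km.
  by split; [exists a|exists b]; apply: tsg.
Qed.

(** The leading coefficient of term [k + 2] is the product of those of the two previous terms and
    the coefficient of [e_(k+2)] in [e_k e_(k+1)]; everything else lies deeper. *)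
Lemma fib_seq_regular n (c : struct n) : Lspace c -> fib c (fib_seq c (E n 0) (E n 1)) ->
  (forall i, (i.+2 < n)%N -> cf (amul c (E n i) (E n i.+1)) i.+2 != 0) ->
  regular (fib_seq c (E n 0) (E n 1)).
Proof.
move=> Lc ff c0; apply: two_step_ind; try exact: regular_E.
move=> k [Vk Nk] [Vk1 Nk1]; rewrite ff; split=> [|kn].
  by apply: (inV_mulr Lc _ Vk1).
have {Nk}Nk := Nk (ltnW (ltnW kn)); have {Nk1}Nk1 := Nk1 (ltnW kn).
set u := fib_seq _ _ _ k in Vk Nk *; set v := fib_seq _ _ _ k.+1 in Vk1 Nk1 *.
have Vu := inV_stepE Vk; have Vv := inV_stepE Vk1.
have -> : amul c u v = amul c (u - cf u k *: E n k) v +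
    cf u k *: amul c (E n k) (v - cf v k.+1 *: E n k.+1) +
    (cf u k * cf v k.+1) *: amul c (E n k) (E n k.+1).
  rewrite amulDl amulDr amulNl amulNr !amulZl amulZr.
  by apply/rowP => l; rewrite !mxE; ring.
rewrite !cfD (inV_cf (inV_mul2 Lc Vu Vk1 (leqnn _))) // add0r.
rewrite (inV_cf (inV_scale _ (inV_mulr Lc _ Vv))) // add0r cfZ.
by rewrite !mulf_neq0 ?c0.
Qed.

(** [XA] and [XB] are intermediate affine-linear families between [L] and the normal form, each with
    its own density argument. *)
Definition XA n (c : struct n) : Prop := [/\ Lspace c, fib c (E n) & condA c 6 6 (E n)].

Definition XB n (c : struct n) : Prop := XA c /\ cf (amul c (E n 0) (E n 2)) 5 = 0.

Lemma reach_A n (c : struct n) : (2 <= n)%N -> Lspace c ->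
  (forall i, (i.+2 < n)%N -> cf (amul c (E n i) (E n i.+1)) i.+2 != 0) ->
  exists g, g \in unitmx /\ XA (tr g c).
Proof.
move=> n2 Lc c0; have ff := fib_seqP c (E n 0) (E n 1).
have [f [[{}ff rf] Af]] := normalize_A Lc (conj ff (fib_seq_regular Lc ff c0)).
have [g [ug Lg fg tg _]] := cond_transport n2 Lc ff (regular_frame rf).
by exists g; split=> //; have [? ? ? ? ?] := Af; split=> //; split; apply: tg.
Qed.

(** Replacing [e_1] by [e_1 + s e_0] kills [c_13^6] for a suitable [s]. *)
Lemma reach_B n (c : struct n) : (2 <= n)%N -> XA c ->
  cf (amul c (E n 0) (E n 2)) 4 != 0 -> cf (amul c (E n 2) (E n 4)) 5 != 0 ->
  exists g, g \in unitmx /\ XB (tr g c).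
Proof.
move=> n2 [Lc fE [f02 f03 f13 f04 f14]].
set p := cf _ 4; set d := cf _ 5; set q := cf (amul c (E n 0) (E n 2)) 5 => p0 d0.
(* Modulo [V_6], [e_0 e_2] is [p e_4 + q e_5] and the new [g_4] is [e_4 + s p d e_5], so
   [e_0 e_2 - p g_4] has [e_5]-coefficient [q - s p^2 d]. *)
pose s := q / (p ^+ 2 * d); pose g := fib_seq c (E n 0) (E n 1 + s *: E n 0).
have fg : fib c g := fib_seqP _ _ _.
have g2 : g 2%N = E n 2.
  by rewrite /g /= amulDr amulZr (amulvv _ Lc.1) scaler0 addr0 -fE.
have g3 : g 3%N = E n 3 + s *: amul c (E n 0) (E n 2).
  by rewrite fg g2 /g /= amulDl amulZl -fE.
have dg k : inV k.+3 (g k.+2 - E n k.+2).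
  apply: (@fib_diff_leading _ _ Lc 2 (fun k => E n k.+2) (fun k => g k.+2)
    (fun k => fE k.+2) (fun k => fg k.+2) (fun k => @inV_E n k.+2)).
  - by rewrite g2 subrr; apply: inV_0.
  - by rewrite g3 addrC addKr; apply: inV_scale.
have gV k : (2 <= k)%N -> inV k (g k).
  case: k => [|[|k]] // _; apply: inV_eq (@inV_E n k.+2).
  exact: inV_le (leqnSn _) (dg k).
have frg : frame g.
  split=> // -[|[|k]] kn.
  - by exists 0; rewrite scale0r addr0; have [Vf /(_ kn)] := @regular_E n 0.
  - exists (- s); rewrite scaleNr /g /= addrK.
    by have [Vf /(_ kn)] := @regular_E n 1.
  exists 0; rewrite scale0r addr0; split; first exact: gV.
  by rewrite -(subrK (E n k.+2) (g k.+2)) cfD (inV_cf (dg k)) // add0r cfE eqxx kn oner_neq0.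
have top w i : (inV 6 (amul c (E n i) (E n 4))) -> inV 4 w -> inV 6 (amul c (E n i) w).
  move=> fi4 Vw; rewrite -(subrK (cf w 4 *: E n 4) w) amulDr amulZr.
  by apply: inV_add; [apply: inV_mulr => //; apply: inV_stepE|apply: inV_scale].
have mul0 i w : inV 6 (amul c (E n 0) w) -> inV 6 (amul c (E n 1) w) -> (i < 2)%N ->
    inV 6 (amul c (g i) w).
  move=> V0 V1; case: i => [|[|//]] _ //.
  by rewrite /g /= amulDl amulZl; apply: inV_add => //; apply: inV_scale.
have e3 i : inV 6 (amul c (E n i) (E n 4)) -> inV 6 (amul c (E n i) (E n 3)) ->
    inV 6 (amul c (E n i) (g 3%N)).
  move=> fi4 fi3; rewrite g3 amulDr; apply: inV_add => //.
  by apply: top => //; apply: inV_scale.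
have [h [uh Lh fh th tsh]] := cond_transport n2 Lc fg frg.
exists h; split=> //; split.
  split=> //; split; apply: th => //.
  - by rewrite g2.
  - by apply: mul0 => //; apply: e3.
  - by apply: mul0 => //; apply: e3.
  - by apply: mul0 => //; apply: top => //; apply: gV.
  - by apply: mul0 => //; apply: top => //; apply: gV.
have: inV 6 (amul (tr h c) (E n 0) (E n 2) - p *: E n 4).
  apply: tsh => //; rewrite g2 [g 4%N]fg g2 g3 -/(g 0%N) /=.
  have V02 := inV_stepE (inV_stepE f02).
  have V24 := inV_stepE (inV_mulr Lc (E n 2) (@inV_E n 4)); rewrite -/d in V24.
  have V25 := inV_mulr Lc (E n 2) (@inV_E n 5).
  set x := amul c (E n 0) (E n 2) in V02 *; rewrite -/p in V02.
  rewrite cfD -/q cfN cfZ cfE /= mulr0 subr0 in V02.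
  have defx : x = p *: E n 4 + q *: E n 5 + (x - p *: E n 4 - q *: E n 5).
    by apply/rowP => l; rewrite !mxE; ring.
  move: V02 defx; set w := (x - _ - _) => Vw defx.
  have -> : x - p *: amul c (E n 2) (E n 3 + s *: x) =
    w - (p * s) *: (p *: (amul c (E n 2) (E n 4) - d *: E n 5) +
      q *: amul c (E n 2) (E n 5) + amul c (E n 2) w).
    rewrite amulDr -fE amulZr {2}defx !amulDr !amulZr {1}defx.
    have -> : q *: E n 5 = (p * s * p * d) *: E n 5.
      by congr (_ *: _); rewrite /s; field; rewrite p0 d0.
    clearbody p d q s w x.
    by apply/rowP => l; rewrite !mxE; ring.
  apply: inV_sub => //; apply: inV_scale; apply: inV_add; last exact: inV_mulr (inV_le _ Vw).
  by apply: inV_add; apply: inV_scale.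
move=> Vp; have := inV_cf Vp (isT : (5 < 6)%N).
rewrite cfD cfN cfZ cfE /= mulr0 subr0; exact.
Qed.

(** * Genericity *)

Definition Tclosure n : struct n -> Prop :=
  zariski_closure (fun c => exists A, Tfam A /\ orbit A c).

Lemma polymap_tr n (g : 'M[C]_n) : polymap (tr g).
Proof.
move=> t; apply: polymx_mul; last exact: polymx_cst.
move=> a l; rewrite ord1; apply: polyfun_amul; [exact: polymap_id|exact: polymx_cst..].
Qed.

Lemma Tclosure_tr n (g : 'M[C]_n) (c : struct n) : g \in unitmx ->
  Tclosure c -> Tclosure (tr g c).
Proof.
move=> ug /closureP clc; apply/closureP => f pf fS.
apply: (clc (fun c => f (tr g c))); first exact: (polyfun_comp (@polymap_tr n g)).
move=> _ [A [TA /orbitP[h [uh ->]]]]; apply: fS; exists A; split=> //.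
by apply/orbitP; exists (g *m h); rewrite unitmx_mul ug uh tr_mul.
Qed.

Lemma Tclosure_of_tr n (g : 'M[C]_n) (c : struct n) : g \in unitmx ->
  Tclosure (tr g c) -> Tclosure c.
Proof. by move=> ug /(Tclosure_tr (etrans (unitmx_inv g) ug)); rewrite trK. Qed.

(** The genericity condition [h] holds at [c1], so on the line from [c] to [c1] it fails at finitely
    many points only. *)
Lemma Tclosure_dense n (X : struct n -> Prop) (h : struct n -> C) c1 c :
  line_closed X -> polyfun h -> X c1 -> h c1 != 0 ->
  (forall c, X c -> h c != 0 -> Tclosure c) -> X c -> Tclosure c.
Proof.
move=> lX ph Xc1 hc1 Xh Xc; apply/closureP => f pf fS.
apply: (line_density (y := c1) pf ph hc1) => t ht.
by have /closureP := Xh _ (lX _ _ t Xc Xc1) ht; apply.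
Qed.

Lemma amul_line n (c c' : struct n) t u v :
  amul (line c c' t) u v = amul c u v + t *: (amul c' u v - amul c u v).
Proof.
apply/rowP => k; rewrite !mxE -sumrB mulr_sumr -big_split; apply: eq_bigr => i _ /=.
rewrite -sumrB mulr_sumr -big_split; apply: eq_bigr => j _ /=.
by rewrite /line; ring.
Qed.

Lemma line_closed_Lspace n : line_closed (@Lspace n).
Proof.
move=> c c' t [/anticommutativeP ac cs] [/anticommutativeP ac' cs']; split.
  by apply/anticommutativeP => i j k; rewrite /line ac ac'; ring.
by move=> i j k kij; rewrite /line cs // cs' // subrr mulr0 addr0.
Qed.

Lemma inV_line n (c c' : struct n) t k u v :
  inV k (amul c u v) -> inV k (amul c' u v) -> inV k (amul (line c c' t) u v).
Proof.
by move=> Vc Vc'; rewrite amul_line; apply: inV_add => //; apply/inV_scale/inV_sub.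
Qed.

Lemma line_closed_XA n : line_closed (@XA n).
Proof.
move=> c c' t [Lc fc [? ? ? ? ?]] [Lc' fc' [? ? ? ? ?]]; split.
- exact: line_closed_Lspace.
- by move=> k; rewrite amul_line -fc -fc' subrr scaler0 addr0.
- by split; apply: inV_line.
Qed.

Lemma line_closed_XB n : line_closed (@XB n).
Proof.
move=> c c' t [Xc c5] [Xc' c5']; split; first exact: line_closed_XA.
by rewrite amul_line cfD cfZ cfD cfN c5 c5' subrr mulr0 addr0.
Qed.

(** One algebra meets all genericity conditions: to [e_i e_(i+1) = e_(i+2)] it adds, in one-based
    indices, [c_13^5 = c_35^6 = c_46^7 = 1]. *)
Definition model_rel (i j k : nat) : bool :=
  ((j == i.+1) && (k == j.+1)) ||
  ((i, j, k) \in [:: (0, 2, 4); (2, 4, 5); (3, 5, 6)]%N).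

Definition model n : struct n := fun t =>
  (model_rel t.1.1 t.1.2 t.2)%:R - (model_rel t.1.2 t.1.1 t.2)%:R.
Arguments model : clear implicits.

Lemma model_rel_lt i j k : model_rel i j k -> (i < j < k)%N.
Proof.
rewrite /model_rel => /orP[/andP[/eqP -> /eqP ->]|]; first by rewrite !leqnn.
by rewrite !inE => /orP[/eqP[-> -> ->]|/orP[]/eqP[-> -> ->]].
Qed.

Lemma cf_model n i j k : (i < n)%N -> (j < n)%N -> (k < n)%N ->
  cf (amul (model n) (E n i) (E n j)) k = (model_rel i j k)%:R - (model_rel j i k)%:R.
Proof.
move=> ni nj nk; rewrite -[ i ]/(nat_of_ord (Ordinal ni)) -[j]/(nat_of_ord (Ordinal nj)).
by rewrite -[k]/(nat_of_ord (Ordinal nk)) cf_ord !E_delta amul_delta.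
Qed.

Lemma model_XB n : (6 <= n)%N -> XB (model n).
Proof.
move=> n6.
have rel0 i j k : (j <= i)%N -> model_rel i j k = false.
  by move=> ji; apply: contraTF ji => /model_rel_lt /andP[ij _]; rewrite -ltnNge.
have inVm i j k : (i < j)%N -> (forall l, (l < k)%N -> model_rel i j l = false) ->
    inV k (amul (model n) (E n i) (E n j)).
  move=> ij kl l lk; have [jn|nj] := ltnP j n; last first.
    by rewrite (E_out nj) amul0r mxE.
  by rewrite -cf_ord cf_model // ?(ltn_trans ij) // kl // rel0 ?subrr // ltnW.
have Lm : Lspace (model n).
  split; first by apply/anticommutativeP => i j k; rewrite /model opprB.
  move=> i j k kij; rewrite /model /=.
  have -> : model_rel i j k = false by apply/negP => /model_rel_lt; lia.
  have -> : model_rel j i k = false by apply/negP => /model_rel_lt; lia.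
  exact: subrr.
split; last first.
  by rewrite cf_model ?subrr //; lia.
split=> //.
  move=> k; have [kn|nk] := ltnP k.+1 n; last first.
    by rewrite (E_out nk) amul0r E_out // ltnW.
  apply/rowP => l; rewrite -!cf_ord cf_model ?ltn_ord // ?cfE ?ltn_ord; last exact: ltnW.
  rewrite (@rel0 k.+1 k) // subr0 andbT /model_rel eqxx /= !inE.
  case: (nat_of_ord l == k.+2) => //=.
  by case: k {kn} => [|[|[|[|k]]]].
by split; apply: inVm => // -[|[|[|[|[|[|l]]]]]].
Qed.

Lemma Tclosure_XB n (c : struct n) : (6 <= n)%N -> XB c -> Tclosure c.
Proof.
(* For [n = 6] there is no [e_7], so the last factor is replaced by 1. *)
move=> n6 Xc; pose r (c : struct n) := if (7 <= n)%N then sc c 4 6 7 else 1.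
apply: (@Tclosure_dense n (@XB n) (fun c => sc c 1 3 5 * sc c 3 5 6 * r c) (model n)) => //.
- exact: line_closed_XB.
- apply: pf_mul; first by apply: pf_mul; apply: polyfun_sc.
  by rewrite /r; case: (7 <= n)%N; [exact: polyfun_sc|exact: pf_const].
- exact: model_XB.
- have n5 : (5 <= n)%N := ltnW n6.
  rewrite !scE !cf_model //; try lia.
  rewrite /r !subr0 !mul1r; case: ifP => [n7|_]; last exact: oner_neq0.
  by rewrite scE cf_model ?subr0 ?oner_neq0 //; lia.
move=> {Xc}c [[Lc fE [f02 f03 f13 f04 f14]] c5].
rewrite !scE !mulf_eq0 !negb_or => /andP[/andP[p0 d0] r0].
have [|g [ug Tg]] := reach_T n6 p0 d0 r0 Lc fE (And5 f02 f03 f13 f04 f14).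
  split.
  - have := inV_stepE (inV_stepE f02).
    by rewrite cfD cfN cfZ cfE /= c5 mulr0 subr0 scale0r subr0.
  - exact: inV_stepE (inV_mulr Lc _ (@inV_E n 4)).
  have V35 := inV_stepE (inV_mulr Lc (E n 3) (@inV_E n 5)).
  rewrite /r; case: ltnP => [n7|n7]; first by rewrite scE.
  have V6 := inV_mulr Lc (E n 3) (@inV_E n 5).
  rewrite (@E_out n 6) // scaler0 subr0 (inV_n _ V6) //; exact: inV_0.
apply: (Tclosure_of_tr ug); apply: sub_closure; exists (tr g c); split=> //.
by apply/orbitP; exists 1%:M; rewrite unitmx1 tr1.
Qed.

Lemma Tclosure_XA n (c : struct n) : (6 <= n)%N -> XA c -> Tclosure c.
Proof.
move=> n6 Xc.
apply: (@Tclosure_dense n (@XA n) (fun c => sc c 1 3 5 * sc c 3 5 6) (model n)) => //.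
- exact: line_closed_XA.
- by apply: pf_mul; apply: polyfun_sc.
- by case: (model_XB n6).
- by rewrite !scE !cf_model ?subr0 ?mul1r ?oner_neq0 //; lia.
move=> {Xc}c Xc; rewrite !scE mulf_eq0 negb_or => /andP[p0 d0].
have n2 : (2 <= n)%N by lia.
have [g [ug Xg]] := reach_B n2 Xc p0 d0.
by apply: (Tclosure_of_tr ug); apply: Tclosure_XB.
Qed.

(** When all these constants are nonzero, [e_0] and [e_1] generate a basis adapted to the flag, and
    the reduction continues through [XA] and [XB]. *)
Lemma Tclosure_Lspace n (c : struct n) : (6 <= n)%N -> Lspace c -> Tclosure c.
Proof.
move=> n6 Lc.
apply: (@Tclosure_dense n (@Lspace n)
  (fun c => \prod_(i < n | (i.+2 < n)%N) sc c i.+1 i.+2 i.+3) (model n)) => //.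
- exact: line_closed_Lspace.
- by apply: polyfun_prod => i _; apply: polyfun_sc.
- by case: (model_XB n6) => -[].
- apply/prodf_neq0 => i i2; have [[_ fm _] _] := model_XB n6.
  by rewrite scE -fm cfE eqxx i2 oner_neq0.
move=> {Lc}c Lc /prodf_neq0 H.
have n2 : (2 <= n)%N by lia.
have [i i2|g [ug Xg]] := reach_A n2 Lc.
  have lt_in : (i < n)%N by lia.
  by have := H (Ordinal lt_in) i2; rewrite scE.
by apply: (Tclosure_of_tr ug); apply: Tclosure_XA.
Qed.

Lemma Tfam_generic n : (6 <= n)%N -> generic (@Tfam n) (@ACN n).
Proof.
move=> n6 c; split=> [/closureP clc|/ACN_Lspace[g [ug Lg]]]; last first.
  by apply: (Tclosure_of_tr ug); apply: Tclosure_Lspace.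
apply: ACN_closed; apply/closureP => f pf fA; apply: clc => // y.
move=> [A [[ac [cs _]] /orbitP[g [ug ->]]]]; apply: fA; apply: tr_ACN => //.
exact: Lspace_ACN.
Qed.

Theorem theoremC :
  (forall n : nat, (6 <= n)%N -> generic (@Tfam n) (@ACN n)) /\
  (forall n : nat, (2 <= n)%N ->
     irreducible (@ACN n) /\
     exists d : nat, has_dim (@ACN n) d /\
       (d * 6 = (n - 2) * (n ^ 2 + 2 * n + 3))%N).
Proof.
split=> n hn; first exact: Tfam_generic.
split; first exact: irreducible_ACN.
by exists #|param_idx n|; split; [exact: ACN_dim|exact: card_param_idx].
Qed.
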